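(* Let $n\ge1$ be an integer and let $0<s<n$. The bilinear Bessel potential $\mathcal J_s$ is bounded $$\mathcal J_s: L^1(\mathbb R^n)\times L^1(\mathbb R^n)\longrightarrow L^{1/2}(\mathbb R^n).$$
   Context: For $0<s<n$, $G_s$ denotes the Bessel kernel of order $s$ on $\mathbb R^n$: the nonnegative integrable function whose Fourier transform (with convention $\widehat{h}(\xi)=\int h(x)e^{-2\pi i x\cdot\xi}\,dx$) is $\widehat{G_s}(\xi)=(1+4\pi^2|\xi|^2)^{-s/2}$. The bilinear Bessel potential is $$\mathcal J_s(f,g)(x)=\int_{\mathbb R^n}G_s(y)\,f(x-y)\,g(x+y)\,dy .$$ Here $\|h\|_{L^{1/2}}=\left(\int_{\mathbb R^n}|h(x)|^{1/2}\,dx\right)^{2}$. Saying that $\mathcal J_s: X\times Y\to Z$ is bounded means that there is a finite constant $C$ such that, for all $f\in X$, $g\in Y$, the defining integral converges absolutely for a.e. $x$ and $\|\mathcal J_s(f,g)\|_Z\le C\|f\|_X\|g\|_Y$. *)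

(* Defs.v *)
From HB Require Import structures.
From mathcomp Require Import all_boot all_order all_algebra.
From mathcomp Require Import all_classical all_reals all_analysis.
From mathcomp Require Import complex.

Set Implicit Arguments.
Unset Strict Implicit.
Unset Printing Implicit Defensive.
Import Order.TTheory GRing.Theory Num.Theory.
Import numFieldNormedType.Exports.

Local Open Scope classical_set_scope.
Local Open Scope ring_scope.
Local Open Scope complex_scope.

(** R^n is [n.-tuple R] with the product sigma-algebra, i.e. the Borel one.
    The n-dimensional Lebesgue measure is built by recursion on [n]: one point
    of mass 1 for [n = 0], then the image of the product of the 1-dimensional
    and the n-dimensional measures under [(t, x) |-> t :: x]. *)
Section lebesgue_measure_tuple.
Context (R : realType).

Definition consT n (p : measurableTypeR R * n.-tuple R) : n.+1.-tuple R :=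
  [tuple of p.1 :: p.2].

Definition unconsT n (x : n.+1.-tuple R) : measurableTypeR R * n.-tuple R :=
  (thead x, [tuple of behead x]).

Lemma unconsTK n : cancel (@unconsT n) (@consT n).
Proof. by move=> x; rewrite /consT /unconsT /= -tuple_eta. Qed.

Lemma consTK n : cancel (@consT n) (@unconsT n).
Proof.
by case=> t x; rewrite /consT /unconsT theadE; congr pair; exact/val_inj.
Qed.

Lemma measurable_consT n : measurable_fun setT (@consT n).
Proof. exact: measurable_cons. Qed.

Lemma measurable_unconsT n : measurable_fun setT (@unconsT n).
Proof.
apply/measurable_fun_pairP; split.
- exact: (measurable_tnth ord0).
- exact: measurable_behead.
Qed.

HB.instance Definition _ n :=
  isMeasurableFun.Build _ _ _ _ (@consT n) (@measurable_consT n).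

Section step.
Context n (m : {sigma_finite_measure set (n.-tuple R) -> \bar R}).

Definition lebesgue_step : set (n.+1.-tuple R) -> \bar R :=
  pushforward (@lebesgue_measure R \x m)%E (@consT n).

Let lebesgue_step0 : lebesgue_step set0 = 0%E.
Proof. exact: measure0. Qed.

Let lebesgue_step_ge0 A : (0 <= lebesgue_step A)%E.
Proof. exact: measure_ge0. Qed.

Let lebesgue_step_sigma_additive : semi_sigma_additive lebesgue_step.
Proof. exact: measure_semi_sigma_additive. Qed.

HB.instance Definition _ := isMeasure.Build _ _ _ lebesgue_step
  lebesgue_step0 lebesgue_step_ge0 lebesgue_step_sigma_additive.

Let lebesgue_step_sigma_finite : sigma_finite setT lebesgue_step.
Proof.
have /sigma_finiteP[F [TF ndF Foo]] := sigma_finiteT (@lebesgue_measure R).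
have /sigma_finiteP[G [TG ndG Goo]] := sigma_finiteT m.
exists (fun k => @unconsT n @^-1` (F k `*` G k)).
  apply/esym; rewrite -subTset => x _.
  have [i _ Fi] : (\bigcup_i F i) (unconsT x).1 by rewrite -TF.
  have [j _ Gj] : (\bigcup_i G i) (unconsT x).2 by rewrite -TG.
  exists (maxn i j) => //; split.
    by move: Fi; exact/subsetPset/ndF/leq_maxl.
  by move: Gj; exact/subsetPset/ndG/leq_maxr.
move=> k; have [mF Fk] := Foo k; have [mG Gk] := Goo k; split.
  rewrite -[X in measurable X]setTI; apply: measurable_unconsT => //.
  exact: measurableX.
rewrite /lebesgue_step /pushforward -comp_preimage.
rewrite (_ : _ \o _ = id); last by apply/funext => x; exact: consTK.
by rewrite preimage_id product_measure1E// lte_mul_pinfty// ge0_fin_numE.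
Qed.

HB.instance Definition _ :=
  Measure_isSigmaFinite.Build _ _ _ lebesgue_step lebesgue_step_sigma_finite.

End step.

Fixpoint lebesgueT n : {sigma_finite_measure set (n.-tuple R) -> \bar R} :=
  match n with
  | 0 => \d_ [tuple]
  | k.+1 => lebesgue_step (lebesgueT k)
  end.

Lemma lebesgueT_box n (A : 'I_n -> set R) : (forall i, measurable (A i)) ->
  lebesgueT n [set x | forall i, A i (tnth x i)] =
  (\prod_(i < n) lebesgue_measure (A i))%E.
Proof.
elim: n A => [|n IHn] A mA.
  by rewrite big_ord0 /= diracE mem_set// => -[].
pose B := [set x : n.-tuple R | forall i, A (lift ord0 i) (tnth x i)].
have mB : measurable B.
  rewrite (_ : B = \bigcap_(i in [set: 'I_n])
      ((fun x : n.-tuple R => tnth x i) @^-1` A (lift ord0 i))); last first.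
    by apply/seteqP; split => x /= h i; [move=> _; exact: h|exact: h].
  apply: fin_bigcap_measurable => [|i _]; first exact: finite_finset.
  by rewrite -[X in measurable X]setTI; exact: measurable_tnth.
rewrite big_ord_recl -(IHn (fun i => A (lift ord0 i)))//.
transitivity ((@lebesgue_measure R \x lebesgueT n) (A ord0 `*` B))%E.
  rewrite /= /lebesgue_step /pushforward; congr (_ _).
  apply/seteqP; split => -[t x]/=.
    move=> h; split; first exact: (h ord0).
    by move=> i; have := h (lift ord0 i); rewrite /consT tnthS.
  case=> h0 h i; case: (unliftP ord0 i) => [j ->|->]; last exact: h0.
  by rewrite /consT tnthS; exact: h.
by rewrite product_measure1E//; exact: (mA ord0).
Qed.

End lebesgue_measure_tuple.

Section vectors.
Context (R : realType) (n : nat).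
Implicit Types x y : n.-tuple R.

Definition vadd x y : n.-tuple R := [tuple tnth x i + tnth y i | i < n].

Definition vsub x y : n.-tuple R := [tuple tnth x i - tnth y i | i < n].

Definition dotp x y : R := \sum_(i < n) tnth x i * tnth y i.

End vectors.

(** Complex-valued functions; measurability and the integral are taken on the
    real and imaginary parts. *)
Section complex_functions.
Context d (T : measurableType d) (R : realType).
Variable mu : {measure set T -> \bar R}.
Implicit Types h : T -> R[i].

Definition cmeasurable h : Prop :=
  measurable_fun setT (fun x => complex.Re (h x)) /\
  measurable_fun setT (fun x => complex.Im (h x)).

Definition cintegral h : R[i] :=
  (\int[mu]_x complex.Re (h x)) +i* (\int[mu]_x complex.Im (h x)).

(** For [p = (2^-1)%:E] this is [(\int |h| `^ 2^-1) `^ 2]. *)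
Definition cLnorm (p : \bar R) h : \bar R :=
  'N[mu]_p[EFin \o (@ComplexField.Normc.normc R \o h)]%E.

Definition in_cLp (p : \bar R) h : Prop :=
  cmeasurable h /\ (cLnorm p h < +oo)%E.

End complex_functions.

Definition expi (R : realType) (t : R) : R[i] := cos t +i* sin t.

Definition fourier (R : realType) n (h : n.-tuple R -> R[i])
    (xi : n.-tuple R) : R[i] :=
  cintegral (lebesgueT R n)
    (fun x => h x * expi (- (2 * pi * dotp x xi))).

(** [G] is a version of the Bessel kernel of order [s]; the conditions determine
    [G] up to a null set. *)
Definition is_bessel_kernel (R : realType) n (s : R) (G : n.-tuple R -> R) :=
  [/\ forall x, 0 <= G x,
      in_cLp (lebesgueT R n) 1 (fun x => (G x)%:C) &
      forall xi, fourier (fun x => (G x)%:C) xi =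
        ((1 + 4 * pi ^+ 2 * dotp xi xi) `^ (- s / 2))%:C].

Section bilinear_potential.
Context (R : realType) (n : nat) (G : n.-tuple R -> R).
Implicit Types f g : n.-tuple R -> R[i].

Definition potential_integrand f g (x y : n.-tuple R) : R[i] :=
  (G y)%:C * f (vsub x y) * g (vadd x y).

Definition bilinear_potential f g (x : n.-tuple R) : R[i] :=
  cintegral (lebesgueT R n) (potential_integrand f g x).

Definition bilinear_potential_bounded (p q r : \bar R) : Prop :=
  exists C : R, forall f g : n.-tuple R -> R[i],
    in_cLp (lebesgueT R n) p f -> in_cLp (lebesgueT R n) q g ->
    [/\ {ae lebesgueT R n, forall x,
           in_cLp (lebesgueT R n) 1 (potential_integrand f g x)},
        in_cLp (lebesgueT R n) r (bilinear_potential f g) &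
        (cLnorm (lebesgueT R n) r (bilinear_potential f g) <=
         C%:E * cLnorm (lebesgueT R n) p f * cLnorm (lebesgueT R n) q g)%E].

End bilinear_potential.

(* Main.v *)
Require Import Defs.
From HB Require Import structures.
From mathcomp Require Import all_boot all_order all_algebra.
From mathcomp Require Import all_classical all_reals all_analysis.
From mathcomp Require Import measurable_realfun complex ring lra.

(** Write [h_w] for the centered Gaussian density on R^n with standard
    deviation [w] in each coordinate.

    The core is a bound for the Gaussian kernel [h_w] in place of [G_s], with a
    constant that does not depend on [w] (lemma [heat_bilinear_le]). For
    [f, g >= 0] let [F(x)] be the integral of [h_w(y) f(x - y) g(x + y)] in
    [y]. Average [sqrt F] against [h_w(x - z)] in [z], exchange the integrals,
    and apply Jensen's inequality to the probability density [h_w(. - z)]: the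
    integral of [sqrt F] is at most that of [sqrt A(z)], where [A(z)] is the
    double integral of [h_w(x - z) h_w(y) f(x - y) g(x + y)] in [x, y]. The
    parallelogram identity gives
    [h_w(y) h_w(v) = 2^n h_w'(v - y) h_w'(v + y)] with [w' = sqrt 2 w]; at
    [v = x - z] and in the variables [x - y], [x + y] the double integral
    splits, so that [A = (h_w' * f) (h_w' * g)]. Hence
    [sqrt A <= (h_w' * f + h_w' * g) / 2], whose integral is half of
    [|f|_1 + |g|_1].

    The Bessel kernel is almost everywhere at most a series of Gaussians with
    coefficients [C e^(- s j)] (lemma [bessel_kernel_le]). Since the square
    root is subadditive and the [e^(- s j / 2)] are still summable, the uniform
    Gaussian bound passes to [G_s] (lemma [ge0_potential_sum_le]). The integral
    of [sqrt (J_s(f, g))] does not change when [(f, g)] becomes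
    [(l f, l^-1 g)], and the best [l] turns the sum [|f|_1 + |g|_1] into a
    geometric mean, which is the claimed inequality (lemma [ge0_potential_le]).
    Complex [f] and [g] reduce to [|f|] and [|g|].

    The domination of [G_s] rests on the subordination formula: up to the
    factor [Gamma(s / 2) / 2], [(1 + |xi|^2)^(- s / 2)] is the integral over the
    line of [e^(s u) exp(- e^(2 u) (1 + |xi|^2))] in [u], and
    [exp(- e^(2 u) |xi|^2)] is the Fourier transform, at the angular frequency
    [xi], of the Gaussian of standard deviation [sqrt 2 e^u]. So a positive
    mixture of Gaussians has the Fourier transform of [G_s], and it agrees with
    [G_s] almost everywhere because an integrable function with vanishing
    Fourier transform is null (lemma [fourier_eq0_ae]). Cutting the integral in
    [u] into the shells [j <= |u| < j + 1] gives the series. *)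
Set Implicit Arguments.
Unset Strict Implicit.
Unset Printing Implicit Defensive.
Import Order.TTheory GRing.Theory Num.Theory.
Import numFieldNormedType.Exports.
Local Open Scope classical_set_scope.
Local Open Scope ring_scope.

(** * Changes of variables for the Lebesgue measure on tuples *)
Section lebesgue_line.
Context (R : realType).
Local Notation mu := (@lebesgue_measure R).

Lemma ge0_integral_shift (c : R) (f : R -> \bar R) :
  measurable_fun [set: R] f -> (forall t, 0 <= f t)%E ->
  (\int[mu]_t f (t + c)%R = \int[mu]_t f t)%E.
Proof.
move=> mf f0.
pose phi (t : measurableTypeR R) : measurableTypeR R := t + c.
have mphi : measurable_fun setT phi by exact: measurable_funD.
transitivity (\int[pushforward mu phi]_t f t)%E.
  by rewrite (ge0_integral_pushforward mphi).
apply: eq_measure_integral => A mA _; apply/esym.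
apply: lebesgue_measure_unique => // _ [[a b]] _ <-.
rewrite /= /pushforward.
rewrite (_ : phi @^-1` _ = [set` `]a - c, b - c]]); last first.
  by apply/seteqP; split => x /=; rewrite /phi !in_itv/= ltrBlDr lerBrDr.
rewrite !lebesgue_measure_itv/= !lte_fin ltrD2r.
by case: ifP => // _; congr (_%:E); rewrite opprB addrA subrK.
Qed.

Lemma ge0_integral_double (f : R -> \bar R) :
  measurable_fun [set: R] f -> (forall t, 0 <= f t)%E ->
  (\int[mu]_t f (t + t)%R = 2^-1%:E * \int[mu]_t f t)%E.
Proof.
move=> mf f0.
pose phi (t : measurableTypeR R) : measurableTypeR R := t + t.
have mphi : measurable_fun setT phi by exact: measurable_funD.
transitivity (\int[pushforward mu phi]_t f t)%E.
  by rewrite (ge0_integral_pushforward mphi).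
pose two : {nonneg R} := NngNum (ler0n R 2).
pose m : {measure set (measurableTypeR R) -> \bar R} :=
  mscale two (pushforward mu phi).
have -> : (\int[mu]_t f t = \int[m mphi]_t f t)%E.
  apply: eq_measure_integral => A mA _.
  apply: lebesgue_measure_unique => // _ [[a b]] _ <-.
  rewrite /m /= /mscale /= /pushforward.
  rewrite (_ : phi @^-1` _ = [set` `]a / 2, b / 2]]); last first.
    apply/seteqP; split => x /=; rewrite /phi !in_itv/= => /andP[h1 h2].
      by apply/andP; split; lra.
    by apply/andP; split; lra.
  rewrite !lebesgue_measure_itv/= !lte_fin ltr_pM2r ?invr_gt0//.
  case: ifP => // _; last by rewrite mule0.
  by rewrite -!EFinD -EFinM; congr (_%:E); lra.
rewrite ge0_integral_mscale// muleA -EFinM/= mulVf ?mul1e//.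
Qed.

End lebesgue_line.

Section tuples.
Context (R : realType).
Local Notation lam n := (lebesgueT R n).

Lemma ge0_integral_consT n (f : n.+1.-tuple R -> \bar R) :
  measurable_fun setT f -> (forall x, 0 <= f x)%E ->
  (\int[lam n.+1]_x f x =
   \int[lebesgue_measure]_t \int[lam n]_x f (consT (t, x)))%E.
Proof.
move=> mf f0.
rewrite (@ge0_integral_pushforward _ _ _ _ _ (@consT R n) (@measurable_consT R n)
  (@lebesgue_measure R \x lam n)%E setT f)//.
rewrite preimage_setT fubini_tonelli1//.
  by apply: measurableT_comp => //; exact: measurable_consT.
by move=> x; exact: f0.
Qed.

Lemma measurable_vadd n d (T : measurableType d) (f g : T -> n.-tuple R) :
  measurable_fun setT f -> measurable_fun setT g ->
  measurable_fun setT (fun t => vadd (f t) (g t)).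
Proof.
move=> mf mg; apply/measurable_fun_tnthP => i.
rewrite (_ : _ \o _ = fun t => tnth (f t) i + tnth (g t) i); last first.
  by apply/funext => t /=; rewrite tnth_mktuple.
by apply: measurable_funD;
  (apply: (measurableT_comp (f := fun x : n.-tuple R => tnth x i)) => //;
   exact: measurable_tnth).
Qed.

Lemma measurable_vsub n d (T : measurableType d) (f g : T -> n.-tuple R) :
  measurable_fun setT f -> measurable_fun setT g ->
  measurable_fun setT (fun t => vsub (f t) (g t)).
Proof.
move=> mf mg; apply/measurable_fun_tnthP => i.
rewrite (_ : _ \o _ = fun t => tnth (f t) i - tnth (g t) i); last first.
  by apply/funext => t /=; rewrite tnth_mktuple.
by apply: measurable_funB;
  (apply: (measurableT_comp (f := fun x : n.-tuple R => tnth x i)) => //;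
   exact: measurable_tnth).
Qed.

Lemma consTP n (x : n.+1.-tuple R) : exists t y, x = consT (t, y).
Proof. by exists (unconsT x).1, (unconsT x).2; rewrite -[LHS]unconsTK; case: unconsT. Qed.

Lemma vadd_consT n s t (x y : n.-tuple R) :
  vadd (consT (s, x)) (consT (t, y)) = consT (s + t, vadd x y).
Proof.
apply: eq_from_tnth => i; rewrite tnth_mktuple.
case: (unliftP ord0 i) => [j ->|->]; last by [].
by rewrite /consT !tnthS tnth_mktuple.
Qed.

Lemma ge0_integral_vadd n (a : n.-tuple R) (f : n.-tuple R -> \bar R) :
  measurable_fun setT f -> (forall x, 0 <= f x)%E ->
  (\int[lam n]_x f (vadd x a) = \int[lam n]_x f x)%E.
Proof.
elim: n a f => [|n IH] a f mf f0.
  by apply: eq_integral => x _; rewrite (tuple0 x) (tuple0 (vadd _ _)).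
have [s [b ->]] := consTP a.
rewrite ge0_integral_consT//; last first.
  by apply: measurableT_comp => //; exact: measurable_vadd.
have mfc (t : R) : measurable_fun setT (fun x : n.-tuple R => f (consT (t, x))).
  exact: (measurableT_comp
    (measurableT_comp mf (@measurable_consT R n)) (pair1_measurable t)).
under eq_integral do under eq_integral do rewrite vadd_consT.
under eq_integral do rewrite (IH _ (fun x => f (consT (_, x))))//.
rewrite [RHS](ge0_integral_consT mf f0).
rewrite (ge0_integral_shift s (f := fun t => \int[lam n]_x f (consT (t, x)))%E)//.
  apply: (measurable_fun_fubini_tonelli_F (fun p => f (consT p))) => //.
  by apply: measurableT_comp => //; exact: measurable_consT.
by move=> t; exact: integral_ge0.
Qed.

Lemma ge0_integral_vdouble n (f : n.-tuple R -> \bar R) :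
  measurable_fun setT f -> (forall x, 0 <= f x)%E ->
  (\int[lam n]_x f (vadd x x) = (2^-1 ^+ n)%:E * \int[lam n]_x f x)%E.
Proof.
elim: n f => [|n IH] f mf f0.
  rewrite expr0 mul1e.
  by apply: eq_integral => x _; rewrite (tuple0 x) (tuple0 (vadd _ _)).
rewrite ge0_integral_consT//; last first.
  by apply: measurableT_comp => //; exact: measurable_vadd.
have mfc (t : R) : measurable_fun setT (fun x : n.-tuple R => f (consT (t, x))).
  exact: (measurableT_comp
    (measurableT_comp mf (@measurable_consT R n)) (pair1_measurable t)).
have mF : measurable_fun setT (fun t : R => \int[lam n]_x f (consT (t, x)))%E.
  apply: (measurable_fun_fubini_tonelli_F (fun p => f (consT p))) => //.
  by apply: measurableT_comp => //; exact: measurable_consT.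
have F0 (t : R) : (0 <= \int[lam n]_x f (consT (t, x)))%E by exact: integral_ge0.
under eq_integral do under eq_integral do rewrite vadd_consT.
under eq_integral do rewrite (IH (fun x => f (consT (_, x))))//.
rewrite ge0_integralZl//; first last.
- apply: (measurableT_comp (f := fun t : R => \int[lam n]_x f (consT (t, x)))%E)=>//.
  exact: measurable_funD.
rewrite (ge0_integral_double (f := fun t => \int[lam n]_x f (consT (t, x)))%E)//.
by rewrite ge0_integral_consT// muleA -EFinM exprSr.
Qed.

(** Translating by [y] in [x], and then by [x] in [y], reduces the linear map
    [(x, y) |-> (x - y, x + y)] to translations and to the dilation
    [y |-> y + y], which alone contributes the Jacobian factor. *)
Lemma ge0_integral_vsub_vadd n (f : n.-tuple R * n.-tuple R -> \bar R) :
  measurable_fun setT f -> (forall x, 0 <= f x)%E ->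
  (\int[lam n]_x \int[lam n]_y f (vsub x y, vadd x y) =
   (2^-1 ^+ n)%:E * \int[lam n]_x \int[lam n]_y f (x, y))%E.
Proof.
move=> mf f0.
pose T := n.-tuple R.
have mg : measurable_fun setT (fun p : T * T => f (vsub p.1 p.2, vadd p.1 p.2)).
  apply: measurableT_comp => //; apply: measurable_fun_pair.
  - exact: measurable_vsub.
  - exact: measurable_vadd.
have mh : measurable_fun setT (fun p : T * T => f (p.1, vadd p.1 (vadd p.2 p.2))).
  apply: measurableT_comp => //; apply: measurable_fun_pair => //.
  by apply: measurable_vadd => //; exact: measurable_vadd.
rewrite (fubini_tonelli (m1 := lam n) (m2 := lam n) _ mg)//=.
transitivity (\int[lam n]_y \int[lam n]_x f (x, vadd x (vadd y y)))%E.
  apply: eq_integral => y _.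
  rewrite -[LHS](ge0_integral_vadd y)//; last first.
    exact: (measurableT_comp mg (pair2_measurable y)).
  apply: eq_integral => x _; congr (f (_, _)); apply: eq_from_tnth => i;
    rewrite !tnth_mktuple.
    by rewrite addrK.
  by rewrite addrA.
rewrite -(fubini_tonelli (m1 := lam n) (m2 := lam n) _ mh)//=.
rewrite -ge0_integralZl//; [|exact: (measurable_fun_fubini_tonelli_F f)
  |by move=> x _; exact: integral_ge0].
apply: eq_integral => x _.
rewrite -(ge0_integral_vadd x (f := fun y => f (x, y)))//; last first.
  exact: (measurableT_comp mf (pair1_measurable x)).
rewrite -(ge0_integral_vdouble (f := fun y => f (x, vadd y x)))//; last first.
  apply: (measurableT_comp mf); apply: measurable_fun_pair => //.
  exact: measurable_vadd.
apply: eq_integral => y _; congr (f (_, _)); apply: eq_from_tnth => i.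
by rewrite !tnth_mktuple addrC.
Qed.

End tuples.

(** * Jensen's inequality for the square root *)
Section root_inequalities.
Context (R : realType).
Local Open Scope ereal_scope.

(** The right-hand side is the tangent line at [r ^+ 2] of the concave square
    root. *)
Lemma poweR_half_le (x : \bar R) (r : R) : 0 <= x -> (0 < r)%R ->
  x `^ 2^-1 <= 2^-1%:E * ((r^-1)%:E * x + r%:E).
Proof.
move=> x0 r0; case: x x0 => [x x0|_|//]; last first.
  by rewrite gt0_muley ?lte_fin ?invr_gt0// addye// gt0_muley ?lte_fin ?invr_gt0// leey.
rewrite poweR_EFin -EFinM lee_fin powR12_sqrt//.
rewrite lee_fin in x0.
have -> : (x = Num.sqrt x ^+ 2)%R by rewrite sqr_sqrtr.
rewrite sqrtr_sqr ger0_norm ?sqrtr_ge0//.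
set y := Num.sqrt x.
rewrite -subr_ge0 (_ : (_ - y)%R = (2^-1 * r^-1 * (y - r) ^+ 2)%R).
  by rewrite mulr_ge0 ?sqr_ge0// mulr_ge0 ?invr_ge0// ltW.
by field; rewrite gt_eqF.
Qed.

Lemma poweR_halfM_le (x y : \bar R) : 0 <= x -> 0 <= y ->
  (x * y) `^ 2^-1 <= 2^-1%:E * (x + y).
Proof.
case: x => [x|_|]//; case: y => [y|_|]//.
- rewrite !lee_fin => x0 y0.
  rewrite powR12_sqrt ?mulr_ge0//.
  rewrite sqrtrM//.
  rewrite -{2}(sqr_sqrtr x0) -{2}(sqr_sqrtr y0).
  have := sqr_ge0 (Num.sqrt x - Num.sqrt y)%R.
  set a := Num.sqrt x; set b := Num.sqrt y; nra.
- by move=> _; rewrite addey// [leRHS]gt0_muley ?lte_fin ?invr_gt0// leey.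
- by move=> *; rewrite addye// [leRHS]gt0_muley ?lte_fin ?invr_gt0// leey.
- by move=> *; rewrite addye// [leRHS]gt0_muley ?lte_fin ?invr_gt0// leey.
Qed.

Lemma measurable_poweR_half d (T : measurableType d) (F : T -> \bar R) :
  measurable_fun setT F -> measurable_fun setT (fun x => F x `^ 2^-1).
Proof. by move=> mF; exact: (measurableT_comp (measurable_poweR _)). Qed.

(** The tangent line bound can be integrated against [p]; the point of tangency
    is then the mean of [F]. *)
Lemma ge0_jensen_poweR_half d (T : measurableType d)
    (mu : {measure set T -> \bar R}) (p : T -> R) (F : T -> \bar R) :
  measurable_fun setT p -> (forall x, 0 <= p x)%R -> \int[mu]_x (p x)%:E = 1 ->
  measurable_fun setT F -> (forall x, 0 <= F x) ->
  \int[mu]_x ((p x)%:E * F x `^ 2^-1) <= (\int[mu]_x ((p x)%:E * F x)) `^ 2^-1.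
Proof.
move=> mp p0 p1 mF F0.
have mpF : measurable_fun setT (fun x => (p x)%:E * F x).
  by apply: emeasurable_funM => //; exact/measurable_EFinP.
have pF0 x : 0 <= (p x)%:E * F x by rewrite mule_ge0// lee_fin.
have bnd (r : R) : (0 < r)%R -> \int[mu]_x ((p x)%:E * F x `^ 2^-1) <=
    2^-1%:E * ((r^-1)%:E * (\int[mu]_x ((p x)%:E * F x)) + r%:E).
  move=> r0.
  have -> : r%:E = r%:E * \int[mu]_x (p x)%:E by rewrite p1 mule1.
  rewrite -ge0_integralZl//; [|by rewrite lee_fin invr_ge0 ltW].
  rewrite -ge0_integralZl//; [|exact/measurable_EFinP
     |by move=> x _; rewrite lee_fin|by rewrite lee_fin ltW].
  rewrite -ge0_integralD//; first last.
  - by apply: measurable_funeM; exact/measurable_EFinP.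
  - by move=> x _; rewrite mule_ge0// lee_fin// ltW.
  - exact: measurable_funeM.
  - by move=> x _; rewrite mule_ge0// lee_fin invr_ge0 ltW.
  rewrite -ge0_integralZl//; first last.
  - move=> x _; rewrite adde_ge0//; last by rewrite mule_ge0// lee_fin// ltW.
    by rewrite mule_ge0// lee_fin invr_ge0 ltW.
  - apply: emeasurable_funD; apply: measurable_funeM => //.
    exact/measurable_EFinP.
  apply: ge0_le_integral => //.
  - by move=> x _; rewrite mule_ge0 ?poweR_ge0// lee_fin.
  - apply: emeasurable_funM; first exact/measurable_EFinP.
    exact: measurable_poweR_half.
  - apply: measurable_funeM.
    apply: emeasurable_funD; apply: measurable_funeM => //.
    exact/measurable_EFinP.
  - move=> x _.
    rewrite [leRHS](_ : _ = (p x)%:E * (2^-1%:E * ((r^-1)%:E * F x + r%:E))).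
      by rewrite lee_wpmul2l ?lee_fin// poweR_half_le.
    rewrite [RHS]muleCA; congr (_ * _).
    rewrite ge0_muleDr//; last 2 first.
      by rewrite mule_ge0// lee_fin invr_ge0 ltW.
      by rewrite lee_fin ltW.
    by rewrite muleCA [r%:E * _]muleC.
have M0 : 0 <= \int[mu]_x ((p x)%:E * F x) by apply: integral_ge0.
set J := \int[mu]_x ((p x)%:E * F x `^ 2^-1) in bnd *.
move: (\int[mu]_x ((p x)%:E * F x)) bnd M0.
case=> [M bnd|_ _|_ //]; last by rewrite poweRyr ?leey// invr_eq0.
rewrite lee_fin le_eqVlt => /orP[/eqP M0|M0].
  (* At mean 0 there is no tangent line; the points of tangency tend to 0. *)
  rewrite -M0 in bnd *; rewrite poweR0r//; apply/lee_addgt0Pr => e e0; rewrite add0e.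
  apply: (le_trans (bnd (e * 2)%R _)); first by rewrite mulr_gt0.
  by rewrite mule0 add0e -EFinM lee_fin; lra.
rewrite poweR_EFin powR12_sqrt; last exact: ltW.
have s0 : (0 < Num.sqrt M)%R by rewrite sqrtr_gt0.
apply: (le_trans (bnd _ s0)).
rewrite -EFinM lee_fin -{2}(sqr_sqrtr (ltW M0)).
set s := Num.sqrt M in s0 *.
by rewrite expr2 mulKf ?gt_eqF//; lra.
Qed.

End root_inequalities.

Section integralZl.
Context d (T : measurableType d) (R : realType) (mu : {measure set T -> \bar R}).

Lemma ge0_integralZlT (f : T -> \bar R) (c : \bar R) : measurable_fun setT f ->
  (forall x, 0 <= f x)%E -> (0 <= c)%E ->
  (\int[mu]_x (c * f x) = c * \int[mu]_x f x)%E.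
Proof. by move=> mf f0 c0; exact: ge0_integralZl. Qed.

Lemma ge0_le_integralT (f g : T -> \bar R) : measurable_fun setT f ->
  measurable_fun setT g -> (forall x, 0 <= f x)%E -> (forall x, f x <= g x)%E ->
  (\int[mu]_x f x <= \int[mu]_x g x)%E.
Proof. by move=> mf mg f0 fg; exact: ge0_le_integral. Qed.

End integralZl.

(** * A bound for Gaussian kernels, uniform in the width *)
Section heat_kernel.
Context (R : realType).
Local Notation lam n := (lebesgueT R n).
Local Notation mu := (@lebesgue_measure R).

(** This is the heat kernel at time [sg ^+ 2 / 2]. *)
Definition heat n (sg : R) (x : n.-tuple R) : R :=
  \prod_(i < n) normal_pdf 0 sg (tnth x i).

Lemma heat_ge0 n sg (x : n.-tuple R) : 0 <= heat sg x.
Proof. by apply: prodr_ge0 => i _; exact: normal_pdf_ge0. Qed.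

Lemma measurable_heat n sg : measurable_fun setT (@heat n sg).
Proof.
apply: measurable_prod => i _.
by apply: measurableT_comp; [exact: measurable_normal_pdf|exact: measurable_tnth].
Qed.

Lemma heat_consT n sg t (x : n.-tuple R) :
  heat sg (consT (t, x)) = normal_pdf 0 sg t * heat sg x.
Proof.
rewrite /heat big_ord_recl; congr (_ * _).
by apply: eq_bigr => i _; rewrite /consT tnthS.
Qed.

Lemma integral_heat n sg : (\int[lam n]_x (heat sg x)%:E = 1)%E.
Proof.
elim: n => [|n IH].
  under eq_integral do rewrite /heat big_ord0.
  by rewrite integral_cst//= diracT mul1e.
rewrite ge0_integral_consT; first last.
- by move=> x; rewrite lee_fin heat_ge0.
- by apply/measurable_EFinP; exact: measurable_heat.
under eq_integral.
  move=> t _; under eq_integral do rewrite heat_consT EFinM.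
  rewrite ge0_integralZl//; [|by apply/measurable_EFinP; exact: measurable_heat
    |by move=> x _; rewrite lee_fin heat_ge0|by rewrite lee_fin normal_pdf_ge0].
  rewrite IH mule1; over.
exact: integral_normal_pdf.
Qed.

Lemma normal_pdfM sg (y u : R) : 0 < sg ->
  normal_pdf 0 sg y * normal_pdf 0 sg u =
  2 * (normal_pdf 0 (Num.sqrt 2 * sg) (u - y) * normal_pdf 0 (Num.sqrt 2 * sg) (u + y)).
Proof.
move=> s0.
have t0 : 0 < Num.sqrt 2 * sg by rewrite mulr_gt0// sqrtr_gt0.
rewrite !normal_pdfE ?gt_eqF// /normal_fun !subr0.
rewrite mulrACA [X in _ = 2 * X]mulrACA -!expRD [RHS]mulrA; congr (_ * _).
  rewrite /normal_peak -!expr2 !exprVn.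
  rewrite !sqr_sqrtr; first last.
  - by rewrite mulrn_wge0// mulr_ge0 ?sqr_ge0 ?pi_ge0.
  - by rewrite mulrn_wge0// mulr_ge0 ?sqr_ge0 ?pi_ge0.
  rewrite exprMn sqr_sqrtr//.
  have : pi != 0 :> R by rewrite gt_eqF// pi_gt0.
  move: (pi : R) => q q0.
  by rewrite -!(mulr_natl (_ * q)); field; rewrite q0 (gt_eqF s0).
congr expR; rewrite exprMn sqr_sqrtr//.
by rewrite -!(mulr_natl (_ ^+ 2) 2) -(mulr_natl (2 * _)); field; rewrite gt_eqF.
Qed.

(** The parallelogram identity
    [|y|^2 + |u|^2 = (|u - y|^2 + |u + y|^2) / 2]: it puts the two arguments
    [u - y] and [u + y] of a bilinear potential into separate factors. *)
Lemma heatM n sg (y u : n.-tuple R) : 0 < sg ->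
  heat sg y * heat sg u =
  2 ^+ n * (heat (Num.sqrt 2 * sg) (vsub u y) * heat (Num.sqrt 2 * sg) (vadd u y)).
Proof.
move=> s0; rewrite /heat -!big_split/=.
rewrite -[X in 2 ^+ X](card_ord n) -prodr_const -big_split/=.
by apply: eq_bigr => i _; rewrite normal_pdfM// !tnth_mktuple.
Qed.

Lemma heatC n sg (x z : n.-tuple R) : sg != 0 ->
  heat sg (vsub x z) = heat sg (vsub z x).
Proof.
move=> s0; apply: eq_bigr => i _; rewrite !tnth_mktuple !normal_pdfE//.
by rewrite /normal_fun !subr0 -[in RHS]opprB sqrrN.
Qed.

Lemma integral_heat_vsub n sg (x : n.-tuple R) : sg != 0 ->
  (\int[lam n]_z (heat sg (vsub x z))%:E = 1)%E.
Proof.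
move=> s0; under eq_integral do rewrite heatC//.
rewrite -(ge0_integral_vadd x (f := fun z => (heat sg (vsub z x))%:E)); last 2 first.
- apply/measurable_EFinP; apply: measurableT_comp; first exact: measurable_heat.
  exact: measurable_vsub.
- by move=> z; rewrite lee_fin heat_ge0.
rewrite -(integral_heat n sg); apply: eq_integral => z _.
congr (heat _ _)%:E; apply: eq_from_tnth => i.
by rewrite !tnth_mktuple addrK.
Qed.

Lemma measurable_heat_vsub n sg d (T : measurableType d) (a b : T -> n.-tuple R) :
  measurable_fun setT a -> measurable_fun setT b ->
  measurable_fun setT (fun t => heat sg (vsub (a t) (b t))).
Proof.
move=> ma mb; apply: measurableT_comp; first exact: measurable_heat.
exact: measurable_vsub.
Qed.

Lemma measurable_bilinear_integrand n (h f g : n.-tuple R -> R) :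
  measurable_fun setT h -> measurable_fun setT f -> measurable_fun setT g ->
  measurable_fun setT (fun p : n.-tuple R * n.-tuple R =>
    h p.2 * f (vsub p.1 p.2) * g (vadd p.1 p.2)).
Proof.
move=> mh mf mg; apply: measurable_funM; first apply: measurable_funM.
- exact: measurableT_comp.
- by apply: measurableT_comp => //; exact: measurable_vsub.
- by apply: measurableT_comp => //; exact: measurable_vadd.
Qed.

(** Since each [heat sg (x - z)] is a probability density both in [x] and in
    [z], averaging in [z] costs nothing and Jensen's inequality in [x] moves the
    root outside, where [heatM] splits the integral into two convolutions. *)
Lemma heat_bilinear_le n sg (f g : n.-tuple R -> R) : 0 < sg ->
  measurable_fun setT f -> measurable_fun setT g ->
  (forall x, 0 <= f x) -> (forall x, 0 <= g x) ->
  (\int[lam n]_x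
     (\int[lam n]_y (heat sg y * f (vsub x y) * g (vadd x y))%:E) `^ 2^-1 <=
   2^-1%:E * (\int[lam n]_x (f x)%:E + \int[lam n]_x (g x)%:E))%E.
Proof.
move=> s0 mf mg f0 g0.
have sn0 : sg != 0 by rewrite gt_eqF.
pose tau := Num.sqrt 2 * sg.
have t0 : tau != 0 by rewrite mulf_neq0// sqrtr_eq0 -ltNge.
pose T := n.-tuple R.
pose F (x : T) := (\int[lam n]_y (heat sg y * f (vsub x y) * g (vadd x y))%:E)%E.
pose A (k : T -> R) (z : T) := (\int[lam n]_u (heat tau (vsub u z) * k u)%:E)%E.
have mheat := measurable_heat (n := n) sg.
have mint : measurable_fun setT (fun p : T * T =>
    (heat sg p.2 * f (vsub p.1 p.2) * g (vadd p.1 p.2))%:E).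
  by apply/measurable_EFinP; exact: measurable_bilinear_integrand.
have int0 (p : T * T) : (0 <= (heat sg p.2 * f (vsub p.1 p.2) * g (vadd p.1 p.2))%:E)%E.
  by rewrite lee_fin !mulr_ge0 ?heat_ge0.
have mF : measurable_fun setT F.
  exact: (measurable_fun_fubini_tonelli_F _ mint int0).
have F0 x : (0 <= F x)%E by apply: integral_ge0 => y _; exact: (int0 (x, y)).
have mhzx : measurable_fun setT (fun p : T * T => heat sg (vsub p.1 p.2)).
  exact: measurable_heat_vsub.
have mAint k : measurable_fun setT k ->
    measurable_fun setT (fun p : T * T => (heat tau (vsub p.1 p.2) * k p.1)%:E).
  move=> mk; apply/measurable_EFinP; apply: measurable_funM.
    exact: measurable_heat_vsub.
  exact: measurableT_comp.
have A0 k z : (forall u, 0 <= k u) -> (0 <= A k z)%E.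
  by move=> k0; apply: integral_ge0 => u _; rewrite lee_fin mulr_ge0 ?heat_ge0.
have mA (k : T -> R) : measurable_fun setT k -> (forall u, 0 <= k u) ->
    measurable_fun setT (A k).
  move=> mk k0; apply: (measurable_fun_fubini_tonelli_G _ (mAint _ mk)).
  by move=> p; rewrite lee_fin mulr_ge0 ?heat_ge0.
have intA (k : T -> R) : measurable_fun setT k -> (forall u, 0 <= k u) ->
    (\int[lam n]_z A k z = \int[lam n]_u (k u)%:E)%E.
  move=> mk k0.
  rewrite -(fubini_tonelli (m1 := lam n) (m2 := lam n) _ (mAint _ mk)); last first.
    by move=> p; rewrite lee_fin mulr_ge0 ?heat_ge0.
  apply: eq_integral => u _ /=.
  under eq_integral do rewrite EFinM.
  rewrite ge0_integralZr//.
  - by rewrite integral_heat_vsub// mul1e.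
  - by apply/measurable_EFinP; exact: measurable_heat_vsub.
  - by move=> z _; rewrite lee_fin heat_ge0.
  - by rewrite lee_fin.
(* [A k] is the convolution of [k] with the Gaussian of width [tau]. *)
have factor z : (\int[lam n]_x ((heat sg (vsub x z))%:E * F x) = A f z * A g z)%E.
  transitivity (\int[lam n]_x \int[lam n]_y
     ((2 ^+ n)%:E * ((heat tau (vsub (vsub x y) z) * f (vsub x y))%:E *
                     (heat tau (vsub (vadd x y) z) * g (vadd x y))%:E)))%E.
    apply: eq_integral => x _; rewrite -ge0_integralZl//; first last.
    - by rewrite lee_fin heat_ge0.
    - by move=> y _; exact: (int0 (x, y)).
    - exact: (measurableT_comp mint (pair1_measurable x)).
    apply: eq_integral => y _; rewrite -!EFinM; congr (_%:E).
    have -> : vsub (vsub x y) z = vsub (vsub x z) y.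
      by apply: eq_from_tnth => i; rewrite !tnth_mktuple; ring.
    have -> : vsub (vadd x y) z = vadd (vsub x z) y.
      by apply: eq_from_tnth => i; rewrite !tnth_mktuple; ring.
    have := heatM y (vsub x z) s0; rewrite -/tau.
    set h1 := heat sg y; set h2 := heat sg _; set h3 := heat tau _.
    set h4 := heat tau _ => h.
    transitivity ((h1 * h2) * f (vsub x y) * g (vadd x y)); first by ring.
    by rewrite h; ring.
  pose Phi (p : T * T) := ((2 ^+ n)%:E * ((heat tau (vsub p.1 z) * f p.1)%:E *
                     (heat tau (vsub p.2 z) * g p.2)%:E))%E.
  have mk (k : T -> R) : measurable_fun setT k ->
      measurable_fun setT (fun u => (heat tau (vsub u z) * k u)%:E).
    move=> ?; apply/measurable_EFinP; apply: measurable_funM => //.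
    exact: measurable_heat_vsub.
  have k0 (k : T -> R) u : (forall u, 0 <= k u) ->
      (0 <= (heat tau (vsub u z) * k u)%:E)%E.
    by move=> ?; rewrite lee_fin mulr_ge0 ?heat_ge0.
  rewrite (ge0_integral_vsub_vadd (f := Phi)); first last.
  - by move=> p; rewrite /Phi !mule_ge0 ?k0// lee_fin exprn_ge0.
  - apply: measurable_funeM; apply: emeasurable_funM.
      exact: (measurableT_comp (mk _ mf)).
    exact: (measurableT_comp (mk _ mg)).
  rewrite /Phi/=.
  transitivity ((2^-1 ^+ n)%:E * \int[lam n]_u ((2 ^+ n)%:E *
      ((heat tau (vsub u z) * f u)%:E * A g z)))%E.
    congr (_ * _)%E; apply: eq_integral => u _.
    rewrite ge0_integralZlT; first congr (_ * _)%E.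
    - by apply: ge0_integralZlT; [exact: mk|move=> v; exact: k0|exact: k0].
    - by apply: measurable_funeM; exact: mk.
    - by move=> v; rewrite mule_ge0 ?k0.
    - by rewrite lee_fin exprn_ge0.
  rewrite ge0_integralZlT; first last.
  - by rewrite lee_fin exprn_ge0.
  - by move=> u; rewrite mule_ge0 ?k0 ?A0.
  - by apply: emeasurable_funM => //; exact: mk.
  under eq_integral do rewrite muleC.
  rewrite ge0_integralZlT; [|exact: mk|by move=> v; exact: k0|exact: A0].
  by rewrite muleA -EFinM -exprMn mulVf// expr1n mul1e muleC.
rewrite [leLHS](_ : _ = \int[lam n]_x \int[lam n]_z
     ((heat sg (vsub x z))%:E * F x `^ 2^-1))%E; last first.
  apply: eq_integral => x _; under [RHS]eq_integral do rewrite muleC.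
  rewrite ge0_integralZlT ?poweR_ge0//.
  - by rewrite integral_heat_vsub// mule1.
  - by apply/measurable_EFinP; exact: measurable_heat_vsub.
  - by move=> z; rewrite lee_fin heat_ge0.
rewrite (fubini_tonelli (m1 := lam n) (m2 := lam n)
  (fun p => ((heat sg (vsub p.1 p.2))%:E * F p.1 `^ 2^-1)%E))/=; first last.
- by move=> p; rewrite mule_ge0 ?poweR_ge0// lee_fin heat_ge0.
- apply: emeasurable_funM; first exact/measurable_EFinP.
  apply: (measurableT_comp (f := fun x => F x `^ 2^-1)%E) => //.
  exact: measurable_poweR_half.
apply: (@le_trans _ _ (\int[lam n]_z (2^-1%:E * (A f z + A g z)))%E).
  apply: ge0_le_integralT.
  - apply: (measurable_fun_fubini_tonelli_G
      (fun p : T * T => ((heat sg (vsub p.1 p.2))%:E * F p.1 `^ 2^-1)%E)).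
    + apply: emeasurable_funM; first exact/measurable_EFinP.
      apply: (measurableT_comp (f := fun x => F x `^ 2^-1)%E) => //.
      exact: measurable_poweR_half.
    + by move=> p; rewrite mule_ge0 ?poweR_ge0// lee_fin heat_ge0.
  - by apply: measurable_funeM; apply: emeasurable_funD; exact: mA.
  - move=> z; apply: integral_ge0 => x _.
    by rewrite mule_ge0 ?poweR_ge0// lee_fin heat_ge0.
  - move=> z; apply: le_trans (poweR_halfM_le (A0 _ z f0) (A0 _ z g0)).
    rewrite -factor; apply: ge0_jensen_poweR_half => //.
    + exact: measurable_heat_vsub.
    + by move=> x; exact: heat_ge0.
    + by under eq_integral do rewrite heatC//; exact: integral_heat_vsub.
rewrite ge0_integralZlT; first last.
- by rewrite lee_fin.
- by move=> z; rewrite adde_ge0 ?A0.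
- by apply: emeasurable_funD; exact: mA.
rewrite ge0_integralD//; [|by move=> z _; exact: A0|exact: mA
  |by move=> z _; exact: A0|exact: mA].
by rewrite !intA.
Qed.

End heat_kernel.

(** * The Fourier transform of a Gaussian *)
Section integral_of_derivative.
Context (R : realType).
Local Notation mu := (@lebesgue_measure R).

(** The bound on [t * Q t] makes the boundary terms at [- N] and [N] vanish in
    the limit. *)
Lemma integral_derive_eq0 (Q q : R -> R) (M : R) :
  (forall t : R, is_derive t (1 : R) Q (q t)) -> continuous q ->
  mu.-integrable setT (EFin \o q) -> (forall t, `|t| * `|Q t| <= M) ->
  (\int[mu]_t (q t)%:E = 0)%E.
Proof.
move=> dQ cq iq QM.
have cQ : continuous Q.
  by move=> t; apply/differentiable_continuous/derivable1_diffP; have [] := dQ t.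
pose S (N : nat) := [set` `[- N.+1%:R, N.+1%:R : R]].
have mS N : measurable (S N) by exact: measurable_itv.
have mq : measurable_fun setT (EFin \o q) by exact: measurable_int iq.
have lim1 : ((\int[mu]_t ((EFin \o q) \_ (S N)) t)%E @[N --> \oo] --> \int[mu]_t (q t)%:E)%E.
  apply: (@dominated_cvg _ _ _ mu setT measurableT _ _ (abse \o (EFin \o q))) => //.
  - move=> N; apply/(measurable_restrictT _ (mS N)).
    exact: measurable_funTS.
  - move=> t _; apply: cvg_near_cst.
    have [k tk] : exists k : nat, `|t| <= k%:R.
      exists (Num.truncn `|t|).+1; exact/ltW/truncnS_gt.
    exists k => // N /= kN; rewrite patchE mem_set//.
    rewrite /S/= in_itv/= -ler_norml (le_trans tk)// ler_nat.
    exact: leq_trans kN _.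
  - exact: integrable_abse.
  - move=> N t _; rewrite patchE; case: ifPn => // _; rewrite abse0.
    exact: abse_ge0.
have lim2 : ((\int[mu]_t ((EFin \o q) \_ (S N)) t)%E @[N --> \oo] --> 0)%E.
  have E N : (\int[mu]_t ((EFin \o q) \_ (S N)) t = (Q N.+1%:R - Q (- N.+1%:R))%:E)%E.
    rewrite -integral_mkcond EFinB; apply: continuous_FTC2.
    - by rewrite (@lt_trans _ _ 0) ?oppr_lt0.
    - exact: continuous_subspaceT.
    - split.
      + by move=> x _; have [] := dQ x.
      + by apply: cvg_at_right_filter; exact: cQ.
      + by apply: cvg_at_left_filter; exact: cQ.
    - by move=> x _; rewrite derive1E; have [_ ->] := dQ x.
  under eq_fun do rewrite E.
  apply: (cvg_EFin); first exact: nearW.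
  rewrite /comp/=.
  apply: norm_cvg0.
  apply: (@squeeze_cvgr _ _ _ _ (cst 0) (fun N => harmonic N * (M + M))).
  - apply: nearW => N; rewrite normr_ge0/= /harmonic mulrDr.
    apply: (le_trans (ler_normB _ _)).
    apply: lerD; rewrite -ler_pdivrMl ?invr_gt0 ?invrK//;
      have := QM (N.+1%:R); have := QM (- N.+1%:R); rewrite normrN ger0_norm//.
  - exact: cvg_cst.
  - by rewrite -[X in _ --> X](mul0r (M + M)); apply: cvgMl; exact: cvg_harmonic.
by apply: (cvg_unique _ lim1 lim2).
Qed.

End integral_of_derivative.

Section gauss_fourier.
Context (R : realType).
Local Notation mu := (@lebesgue_measure R).
Variables (sg : R) (sg0 : 0 < sg).

Let p : R -> R := normal_pdf 0 sg.

Let pE : p = fun t => normal_peak sg * expR (- t ^+ 2 / (sg ^+ 2 *+ 2)).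
Proof.
by apply/funext => t; rewrite /p normal_pdfE ?gt_eqF// /normal_fun subr0.
Qed.

Let derive_p (t : R) : is_derive t (1 : R) p (- (t / sg ^+ 2) * p t).
Proof.
rewrite pE; apply: is_derive_eq.
have scaleE (a b : R) : a *: (b : R^o) = a * b by [].
rewrite !scaleE -!(mulr_natr (sg ^+ 2)).
by field; rewrite gt_eqF.
Qed.

Let p2 : R -> R := normal_pdf 0 (Num.sqrt 2 * sg).

(** Half of the Gaussian exponent suffices to absorb the factor [t], by
    [2 * v <= 1 + v ^+ 2 <= expR (v ^+ 2)]; the other half is the density with
    twice the variance. *)
Let normr_p_le : exists C, 0 <= C /\ forall t : R, `|t| * p t <= C * p2 t.
Proof.
have s2 : Num.sqrt 2 * sg != 0 :> R by rewrite mulf_neq0 ?gt_eqF// sqrtr_gt0.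
have P := @normal_peak_gt0 R _ s2.
exists (sg * normal_peak sg / normal_peak (Num.sqrt 2 * sg)); split => [|t].
  by rewrite divr_ge0 ?normal_peak_ge0// mulr_ge0 ?normal_peak_ge0// ltW.
rewrite pE /p2 normal_pdfE// /normal_fun subr0.
rewrite [leRHS](_ : _ = normal_peak sg * (sg * expR (- t ^+ 2 /
    ((Num.sqrt 2 * sg) ^+ 2 *+ 2)))); last by field; rewrite gt_eqF.
rewrite mulrCA ler_pM2l ?normal_peak_gt0 ?gt_eqF//.
rewrite exprMn sqr_sqrtr//.
have -> : - t ^+ 2 / (sg ^+ 2 *+ 2) =
    - t ^+ 2 / (2 * sg ^+ 2 *+ 2) - (`|t| / (2 * sg)) ^+ 2.
  rewrite expr_div_n real_normK ?num_real// -(mulr_natr (sg ^+ 2)) -(mulr_natr (2 * _)).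
  by field; rewrite gt_eqF.
rewrite expRD mulrCA [leRHS]mulrC ler_pM2l ?expR_gt0// expRN ler_pdivrMr ?expR_gt0//.
set u := `|t| / (2 * sg).
have -> : `|t| = 2 * sg * u by rewrite /u mulrCA mulfV ?mulr1// mulf_neq0// gt_eqF.
rewrite mulrAC mulrC ler_pM2l//.
apply: le_trans (expR_ge1Dx _).
by rewrite -subr_ge0 (_ : _ - _ = (1 - u) ^+ 2) ?sqr_ge0//; ring.
Qed.

Let integrable_normr_p : mu.-integrable setT (fun t => (`|t| * p t)%:E).
Proof.
have [C [C0 HC]] := normr_p_le.
apply: (le_integrable measurableT _ _ (integrableZl measurableT C
  (integrable_normal_pdf 0 (Num.sqrt 2 * sg)))).
  apply/measurable_EFinP; apply: measurable_funM.
    exact: normr_measurable.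
  exact: measurable_normal_pdf.
move=> t _ /=.
rewrite lee_fin ger0_norm ?mulr_ge0 ?normal_pdf_ge0//.
by apply: (le_trans (HC t)); exact: ler_norm.
Qed.

Let integrable_p_bnd (h : R -> R) (M : R) : measurable_fun setT h ->
  (forall t, `|h t| <= M) -> mu.-integrable setT (fun t => (p t * h t)%:E).
Proof.
move=> mh hM.
apply: (le_integrable measurableT _ _ (integrableZl measurableT M (integrable_normal_pdf 0 sg))).
  by apply/measurable_EFinP; apply: measurable_funM => //; exact: measurable_normal_pdf.
move=> t _ /=; rewrite lee_fin !normrM mulrC ler_wpM2r//.
by rewrite (le_trans (hM t))// ler_norm.
Qed.

Variable c : R.

Let F (eta : R) := \int[mu]_t (p t * cos (c + t * eta)).

Let cont_lin (eta : R) : continuous (fun t : R => c + t * eta).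
Proof. by move=> t; apply: cvgD; [exact: cvg_cst|apply: cvgMl; exact: cvg_id]. Qed.

Let meas_cos (eta : R) : measurable_fun setT (fun t : R => cos (c + t * eta)).
Proof.
apply: continuous_measurable_fun => t.
by apply: continuous_comp; [exact: cont_lin|exact: continuous_cos].
Qed.

Let meas_sin (eta : R) : measurable_fun setT (fun t : R => sin (c + t * eta)).
Proof.
apply: continuous_measurable_fun => t.
by apply: continuous_comp; [exact: cont_lin|exact: continuous_sin].
Qed.

Let integrable_xsin (eta : R) :
  mu.-integrable setT (fun t => (t * p t * sin (c + t * eta))%:E).
Proof.
apply: (le_integrable measurableT _ _ integrable_normr_p).
  apply/measurable_EFinP; apply: measurable_funM; last exact: meas_sin.
  by apply: measurable_funM => //; exact: measurable_normal_pdf.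
move=> t _ /=; rewrite lee_fin !normrM normr_id ler_piMr ?mulr_ge0//.
by rewrite ler_norml sin_geN1 sin_le1.
Qed.

Let integrable_pcos (eta : R) :
  mu.-integrable setT (fun t => (p t * cos (c + t * eta))%:E).
Proof.
apply: (integrable_p_bnd (M := 1)) => [|t]; first exact: meas_cos.
by rewrite ler_norml cos_geN1 cos_le1.
Qed.

(** The integral of the derivative of [p t * sin (c + t * eta)] is 0, and
    [p] satisfies [p' = - (t / sg ^+ 2) * p]. *)
Let ibp (eta : R) :
  \int[mu]_t (t * p t * sin (c + t * eta)) = sg ^+ 2 * eta * F eta.
Proof.
pose Q (t : R) := p t * sin (c + t * eta).
pose q (t : R) := - (sg ^+ 2)^-1 * (t * p t * sin (c + t * eta)) +
   eta * (p t * cos (c + t * eta)).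
have dQ (t : R) : is_derive t (1 : R) Q (q t).
  have scaleE (a b : R) : a *: (b : R^o) = a * b by [].
  have dp := derive_p; rewrite /Q; apply: is_derive_eq.
  by rewrite /q !scaleE; field; rewrite gt_eqF.
have cp : continuous p by apply: continuous_normal_pdf; rewrite gt_eqF.
have cq : continuous q.
  move=> t; apply: cvgD; apply: cvgM; [exact: cvg_cst| |exact: cvg_cst|].
  - apply: cvgM; first by apply: cvgM; [exact: cvg_id|exact: cp].
    by apply: continuous_comp; [exact: cont_lin|exact: continuous_sin].
  - apply: cvgM; first exact: cp.
    by apply: continuous_comp; [exact: cont_lin|exact: continuous_cos].
have iq : mu.-integrable setT (EFin \o q).
  rewrite (_ : _ \o _ = (fun t => (- (sg ^+ 2)^-1)%:E * (t * p t * sin (c + t * eta))%:E)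
    \+ (fun t => eta%:E * (p t * cos (c + t * eta))%:E))%E; last first.
    by apply/funext => t; rewrite /q/= EFinD !EFinM.
  apply: integrableD => //; apply: integrableZl => //.
have [C [C0 HC]] := normr_p_le.
have QM t : `|t| * `|Q t| <= C * normal_peak (Num.sqrt 2 * sg).
  apply: (@le_trans _ _ (`|t| * p t)).
    rewrite ler_wpM2l// /Q normrM ger0_norm ?normal_pdf_ge0//.
    by rewrite ler_piMr ?normal_pdf_ge0// ler_norml sin_geN1 sin_le1.
  apply: (le_trans (HC t)); rewrite ler_wpM2l//; apply: normal_pdf_ub.
  by rewrite mulf_neq0 ?gt_eqF// sqrtr_gt0.
have := integral_derive_eq0 dQ cq iq QM.
move=> /(congr1 fine); rewrite /= -/(Rintegral mu setT q).
rewrite /q RintegralD//;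
  [|exact: (integrableZl measurableT _ (integrable_xsin eta))
   |exact: (integrableZl measurableT _ (integrable_pcos eta))].
rewrite (RintegralZl _ measurableT (integrable_xsin eta)).
rewrite (RintegralZl _ measurableT (integrable_pcos eta)) -/(F eta).
move=> /eqP; rewrite addr_eq0 mulNr eqr_opp.
move=> /eqP h; apply: (@mulfI _ (sg ^+ 2)^-1).
  by rewrite invr_eq0 expf_eq0/= gt_eqF.
by rewrite h -mulrA mulKf// expf_eq0/= gt_eqF.
Qed.

(** Differentiating under the integral produces the left-hand side of [ibp], so
    [F] solves a linear differential equation of the first order. *)
Let derive_F (eta : R) : is_derive eta (1 : R) F (- (sg ^+ 2 * eta) * F eta).
Proof.
pose f (e t : R) := p t * cos (c + t * e).
have df (e t : R) : is_derive e (1 : R) (f ^~ t) (- (t * p t * sin (c + t * e))).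
  have scaleE (a b : R) : a *: (b : R^o) = a * b by [].
  by rewrite /f; apply: is_derive_eq; rewrite !scaleE; ring.
have d1 (e t : R) : partial1of2 f e t = - (t * p t * sin (c + t * e)).
  by rewrite partial1of2E; have [_ ->] := df e t.
have Ie : eta \in `]eta - 1, eta + 1[ by rewrite in_itv/= ltrBlDr ltrDl ltr01.
have intf x : `]eta - 1, eta + 1[%classic x -> mu.-integrable setT (EFin \o f x).
  by move=> _; exact: integrable_pcos.
have derf x y : `]eta - 1, eta + 1[%classic x -> setT y -> derivable (f^~ y) x 1.
  by move=> _ _; have [] := df x y.
have Gub x y : `]eta - 1, eta + 1[%classic x -> setT y -> `|partial1of2 f x y| <= `|y| * p y.
  move=> _ _; rewrite d1 normrN !normrM (ger0_norm (normal_pdf_ge0 _ _ _)).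
  by rewrite ler_piMr ?mulr_ge0 ?normal_pdf_ge0// ler_norml sin_geN1 sin_le1.
have G0 y : 0 <= `|y| * p y by rewrite mulr_ge0 ?normal_pdf_ge0.
apply: DeriveDef.
  exact: (derivable_under_integral measurableT Ie intf derf G0 integrable_normr_p Gub).
rewrite -derive1E.
rewrite (differentiation_under_integral measurableT Ie intf derf G0 integrable_normr_p Gub).
rewrite mulNr -ibp -mulN1r -(RintegralZl _ measurableT (integrable_xsin eta)).
by apply: eq_Rintegral => t _; rewrite d1 mulN1r.
Qed.

Lemma Rintegral_normal_pdf_cos (eta : R) :
  \int[mu]_t (normal_pdf 0 sg t * cos (c + t * eta)) =
  expR (- (sg ^+ 2 * eta ^+ 2) / 2) * cos c.
Proof.
rewrite -/(F eta).
pose E (e : R) := F e * expR (sg ^+ 2 * e ^+ 2 / 2).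
have dE (e : R) : is_derive e (1 : R) E 0.
  have scaleE (a b : R) : a *: (b : R^o) = a * b by [].
  have dF := derive_F; rewrite /E; apply: is_derive_eq.
  by rewrite !scaleE; field.
have E0 : E 0 = cos c.
  rewrite /E expr0n/= mulr0 mul0r expR0 mulr1 /F.
  under eq_Rintegral do rewrite mulr0 addr0.
  rewrite RintegralZr//; last exact: integrable_normal_pdf.
  by rewrite /Rintegral integral_normal_pdf mul1r.
rewrite -E0 (is_derive_0_is_cst 0 eta dE) /E mulrC mulrAC -mulrA -expRD.
by rewrite -mulrDl addNr mul0r expR0 mulr1.
Qed.

Lemma integrable_normal_pdf_cos (eta : R) :
  mu.-integrable setT (fun t => (normal_pdf 0 sg t * cos (c + t * eta))%:E).
Proof. exact: integrable_pcos. Qed.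

End gauss_fourier.

Section heat_fourier.
Context (R : realType).
Local Notation lam n := (lebesgueT R n).
Local Notation mu := (@lebesgue_measure R).

Lemma dotp_consT n (t s : R) (x y : n.-tuple R) :
  dotp (consT (t, x)) (consT (s, y)) = t * s + dotp x y.
Proof.
rewrite /dotp big_ord_recl; congr (_ + _).
by apply: eq_bigr => i _; rewrite /consT !tnthS.
Qed.

Lemma measurable_dotp n (xi : n.-tuple R) : 
  measurable_fun setT (fun x : n.-tuple R => dotp x xi).
Proof.
apply: measurable_sum => i; apply: measurable_funM => //.
exact: measurable_tnth.
Qed.

Lemma measurable_cos_dotp n (c : R) (xi : n.-tuple R) :
  measurable_fun setT (fun x : n.-tuple R => cos (c + dotp x xi)).
Proof.
apply: (measurableT_comp (f := @cos R)).
  by apply: continuous_measurable_fun; exact: continuous_cos.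
by apply: measurable_funD => //; exact: measurable_dotp.
Qed.

Lemma integrable_heat n (sg : R) :
  (lam n).-integrable setT (fun x => (heat sg x)%:E).
Proof.
apply/integrableP; split.
  by apply/measurable_EFinP; exact: measurable_heat.
under eq_integral do rewrite /= ger0_norm ?heat_ge0//.
by rewrite integral_heat ltry.
Qed.

(** A phase [c] is carried along since the cosine of a sum of coordinates is
    not a product: the first coordinate becomes part of the phase in the
    induction on the dimension. *)
Lemma integral_heat_cos n (sg c : R) (xi : n.-tuple R) : 0 < sg ->
  (\int[lam n]_x (heat sg x * cos (c + dotp x xi))%:E =
   (expR (- (sg ^+ 2 * dotp xi xi) / 2) * cos c)%:E)%E.
Proof.
move=> sg0; elim: n c xi => [|n IH] c xi.
  rewrite /dotp big_ord0 mulr0 oppr0 mul0r expR0 mul1r.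
  under eq_integral do rewrite /heat big_ord0 mul1r /dotp big_ord0 addr0.
  by rewrite integral_cst//= diracT mule1.
have [s [eta ->]] := consTP xi.
pose f (x : n.+1.-tuple R) := (heat sg x * cos (c + dotp x (consT (s, eta))))%:E.
have mf : measurable_fun setT f.
  apply/measurable_EFinP; apply: measurable_funM; first exact: measurable_heat.
  exact: measurable_cos_dotp.
have mfc : measurable_fun setT (f \o @consT R n).
  by apply: measurableT_comp => //; exact: measurable_consT.
have intf : (mu \x lam n)%E.-integrable setT (f \o @consT R n).
  apply/integrable12ltyP => //.
  rewrite -(ge0_integral_consT (f := abse \o f)); last 2 first.
  - exact: measurableT_comp.
  - by move=> x; exact: abse_ge0.
  apply: (@le_lt_trans _ _ (\int[lam n.+1]_x (heat sg x)%:E)%E).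
    apply: ge0_le_integralT.
    - exact: measurableT_comp.
    - by apply/measurable_EFinP; exact: measurable_heat.
    - by move=> x; exact: abse_ge0.
    - move=> x; rewrite /= lee_fin normrM ger0_norm ?heat_ge0//.
      by rewrite ler_piMr ?heat_ge0// ler_norml cos_geN1 cos_le1.
  by rewrite integral_heat ltry.
rewrite -/(f _) (@integral_pushforward _ _ _ _ _ (@consT R n)
  (@measurable_consT R n) (mu \x lam n)%E setT f) => //.
rewrite preimage_setT -integral12_prod_meas1//.
transitivity (\int[mu]_t ((expR (- (sg ^+ 2 * dotp eta eta) / 2))%:E *
   (normal_pdf 0 sg t * cos (c + t * s))%:E))%E.
  apply: eq_integral => t _; rewrite /fubini_F /f /=.
  under eq_integral do rewrite heat_consT dotp_consT addrA -mulrA EFinM.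
  rewrite integralZl//; last first.
    apply: (le_integrable measurableT _ _ (integrable_heat n sg)).
      apply/measurable_EFinP; apply: measurable_funM; first exact: measurable_heat.
      exact: measurable_cos_dotp.
    move=> x _; rewrite /= lee_fin normrM ler_piMr//.
    by rewrite ler_norml cos_geN1 cos_le1.
  by rewrite IH -!EFinM; congr (_%:E); ring.
rewrite integralZl//; last exact: integrable_normal_pdf_cos.
rewrite -[X in (_ * X)%E]fineK; last first.
  apply: integrable_fin_num => //; exact: integrable_normal_pdf_cos.
rewrite -/(Rintegral mu setT (fun t => normal_pdf 0 sg t * cos (c + t * s))).
rewrite Rintegral_normal_pdf_cos// -EFinM mulrA -expRD dotp_consT.
by congr ((expR _ * _)%:E); ring.
Qed.

End heat_fourier.

(** * Integrable functions with vanishing Fourier transform *)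
Section threshold.
Context (R : realType).

Lemma bernoulli_ge (v : R) k : 0 <= v -> 1 + k%:R * v <= (1 + v) ^+ k.
Proof.
move=> v0; elim: k => [|k IH]; first by rewrite mul0r addr0 expr0.
rewrite exprS; apply: (@le_trans _ _ ((1 + v) * (1 + k%:R * v))).
  rewrite -natr1 -subr_ge0 (_ : _ - _ = k%:R * v ^+ 2); last by ring.
  by rewrite mulr_ge0 ?sqr_ge0.
by rewrite ler_wpM2l// addr_ge0.
Qed.

Lemma bernoulli_le (v : R) k : v <= 1 -> 1 - k%:R * v <= (1 - v) ^+ k.
Proof.
move=> v1; elim: k => [|k IH]; first by rewrite mul0r subr0 expr0.
rewrite exprS; apply: (@le_trans _ _ ((1 - v) * (1 - k%:R * v))).
  rewrite -natr1 -subr_ge0 (_ : _ - _ = k%:R * v ^+ 2); last by ring.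
  by rewrite mulr_ge0 ?sqr_ge0.
by rewrite ler_wpM2l// subr_ge0.
Qed.

(** Bernoulli's inequality for [z^(- k / 2)] bounds [k * z^(k / 2)]; the
    remaining factor [z^(k / 2)] tends to 0. *)
Lemma cvg_natM_expr (z : R) : 0 <= z < 1 -> k%:R * z ^+ k @[k --> \oo] --> (0 : R).
Proof.
case/andP=> z0 z1.
have [->|zn0] := eqVneq z 0.
  apply: cvg_near_cst; exists 1%N => // k /= k1.
  by rewrite expr0n gtn_eqF// mulr0.
have zp : 0 < z by rewrite lt_def zn0.
pose y := Num.sqrt z.
have y0 : 0 < y by rewrite sqrtr_gt0.
have yz : y ^+ 2 = z by rewrite sqr_sqrtr.
have y1 : y < 1 by rewrite -sqrtr1 ltr_sqrt.
pose e := y^-1 - 1.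
have e0 : 0 < e by rewrite subr_gt0 invf_gt1.
apply: (@squeeze_cvgr _ _ _ _ (cst 0) (fun k => e^-1 * y ^+ k)).
- apply: nearW => k; rewrite mulr_ge0 ?exprn_ge0//=.
  rewrite -yz -exprM mulnC exprM expr2 mulrA ler_wpM2r ?exprn_ge0 ?(ltW y0)//.
  rewrite -[leRHS]mulr1 ler_pdivlMl// mulrA.
  have := bernoulli_ge k (ltW e0).
  rewrite {2}/e addrCA subrr addr0 exprVn => h.
  rewrite -ler_pdivlMr ?exprn_gt0// mul1r; apply: le_trans h.
  by rewrite mulrC lerDr.
- exact: cvg_cst.
- rewrite -[X in _ --> X](mulr0 e^-1); apply: cvgMr; apply: cvg_expr.
  by rewrite ger0_norm// ltW.
Qed.

(** Polynomials in [u] that tend pointwise on [0, 1] to the indicator of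
    [u < 2^-1]. Raising [1 - u ^+ k] to the power [k * 2 ^ k] compares [u] to
    [2^-1]: by Bernoulli's inequality the result is close to 1 when
    [k * (2 * u) ^+ k] is small and close to 0 when it is large. The additional
    factor [k] decides the case [u = 2^-1]. *)
Definition threshold k (u : R) : R := (1 - u ^+ k) ^+ (k * 2 ^ k).

Lemma threshold01 k u : 0 <= u <= 1 -> 0 <= threshold k u <= 1.
Proof.
case/andP=> u0 u1; have uk0 : 0 <= u ^+ k by exact: exprn_ge0.
have uk1 : u ^+ k <= 1 by exact: exprn_ile1.
by rewrite exprn_ge0 ?subr_ge0// exprn_ile1 ?subr_ge0// lerBlDr lerDl.
Qed.

Lemma cvg_threshold u : 0 <= u <= 1 ->
  threshold k u @[k --> \oo] --> ((u < 2^-1)%R%:R : R).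
Proof.
move=> u01; have /andP[u0 u1] := u01.
have E k : (k * 2 ^ k)%:R * u ^+ k = k%:R * (2 * u) ^+ k.
  by rewrite natrM natrX exprMn mulrA.
case: (ltP u 2^-1) => u2.
  apply: (@squeeze_cvgr _ _ _ _ (fun k => 1 - k%:R * (2 * u) ^+ k) (cst 1)).
  - apply: nearW => k; have /andP[_ ->] := threshold01 k u01; rewrite andbT.
    by rewrite -E; apply: bernoulli_le; exact: exprn_ile1.
  - rewrite -[X in _ --> X]subr0; apply: cvgB; first exact: cvg_cst.
    by apply: cvg_natM_expr; apply/andP; split; lra.
  - exact: cvg_cst.
apply: (@squeeze_cvgr _ _ _ _ (cst 0) (fun k => k.+1%:R^-1)).
- apply: nearW => k; have /andP[-> _] := threshold01 k u01 => /=.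
  rewrite -[leRHS]mul1r ler_pdivlMr ?ltr0n//.
  have uk0 : 0 <= u ^+ k by exact: exprn_ge0.
  have uk1 : u ^+ k <= 1 by exact: exprn_ile1.
  have h1 : k.+1%:R <= (1 + u ^+ k) ^+ (k * 2 ^ k) :> R.
    apply: le_trans (bernoulli_ge _ uk0); rewrite E -natr1 addrC lerD2l.
    by rewrite ler_peMr// exprn_ege1//; lra.
  apply: (@le_trans _ _ (threshold k u * (1 + u ^+ k) ^+ (k * 2 ^ k))).
    by rewrite ler_wpM2l//; have /andP[] := threshold01 k u01.
  rewrite /threshold -exprMn exprn_ile1//; last by nra.
  by rewrite mulr_ge0 ?subr_ge0// addr_ge0.
- exact: cvg_cst.
- exact: cvg_harmonic.
Qed.

End threshold.

Section uniqueness.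
Context (R : realType) (n : nat).
Local Notation T := (n.-tuple R).
Local Notation mu := (lebesgueT R n).
Variable D : T -> R.
Hypothesis intD : mu.-integrable setT (EFin \o D).
Hypothesis fourierD0 : forall c xi, (\int[mu]_x (D x * cos (c + dotp x xi))%:E = 0)%E.

Let bounded_meas (h : T -> R) :=
  measurable_fun setT h /\ exists M, forall x, `|h x| <= M.

(** The weights [h] such that [D * h] has vanishing Fourier transform too. *)
Let ann (h : T -> R) := bounded_meas h /\
  forall c xi, (\int[mu]_x (D x * (h x * cos (c + dotp x xi)))%:E = 0)%E.

(** The multipliers of [ann] form an algebra, which [ann] itself need not be,
    and the algebra is closed under bounded pointwise limits. *)
Let mult (m : T -> R) := bounded_meas m /\
  forall h, ann h -> ann (fun x => m x * h x).

Let int_bounded h : bounded_meas h ->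
  mu.-integrable setT (fun x => (D x * h x)%:E).
Proof.
move=> [mh [M hM]].
have mD : measurable_fun setT D by apply/measurable_EFinP; exact: measurable_int intD.
apply: (le_integrable measurableT _ _ (integrableZl measurableT M intD)).
  by apply/measurable_EFinP; apply: measurable_funM.
move=> x _ /=; rewrite lee_fin !normrM mulrC ler_wpM2r//.
by rewrite (le_trans (hM x))// ler_norm.
Qed.

Let bm_cos c xi : bounded_meas (fun x => cos (c + dotp x xi)).
Proof.
split; first exact: measurable_cos_dotp.
by exists 1 => x; rewrite ler_norml cos_geN1 cos_le1.
Qed.

Let bmM h k : bounded_meas h -> bounded_meas k -> bounded_meas (fun x => h x * k x).
Proof.
move=> [mh [M hM]] [mk [N kN]]; split; first exact: measurable_funM.
by exists (M * N) => x; rewrite normrM ler_pM.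
Qed.

Let bm_lin a b h k : bounded_meas h -> bounded_meas k ->
  bounded_meas (fun x => a * h x + b * k x).
Proof.
move=> [mh [M hM]] [mk [N kN]]; split.
  by apply: measurable_funD; exact: measurable_funM.
exists (`|a| * M + `|b| * N) => x; apply: (le_trans (ler_normD _ _)).
by rewrite !normrM lerD// ler_wpM2l.
Qed.

Let ann_lin a b h k : ann h -> ann k -> ann (fun x => a * h x + b * k x).
Proof.
move=> [bh h0] [bk k0]; split; first exact: bm_lin.
move=> c xi.
have ih := int_bounded (bmM bh (bm_cos c xi)).
have ik := int_bounded (bmM bk (bm_cos c xi)).
under eq_integral.
  move=> x _; rewrite [X in X%:E](_ : _ = a * (D x * (h x * cos (c + dotp x xi))) +
    b * (D x * (k x * cos (c + dotp x xi)))); last by ring.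
  rewrite EFinD !EFinM; over.
rewrite integralD//; [|exact: integrableZl|exact: integrableZl].
by rewrite !integralZl// h0 k0 !mule0 adde0.
Qed.

Let bm_lim (h_ : nat -> T -> R) h M : (forall k, bounded_meas (h_ k)) ->
  (forall k x, `|h_ k x| <= M) -> (forall x, h_ k x @[k --> \oo] --> h x) ->
  bounded_meas h.
Proof.
move=> ah hM hl; split.
  apply: (measurable_fun_cvg (h := h_)) => [k|x _]; [by have [] := ah k|exact: hl].
exists M => x; apply: (@closed_cvg _ _ \oo _ (fun k => `|h_ k x|) (fun r => r <= M)).
- exact: closed_le.
- by apply: nearW => k; exact: hM.
- by apply: cvg_norm; exact: hl.
Qed.

Let ann_lim (h_ : nat -> T -> R) h M : (forall k, ann (h_ k)) ->
  (forall k x, `|h_ k x| <= M) -> (forall x, h_ k x @[k --> \oo] --> h x) ->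
  ann h.
Proof.
move=> ah hM hl; split; first by apply: (bm_lim _ hM hl) => k; have [] := ah k.
move=> c xi.
have bc k := bmM (ah k).1 (bm_cos c xi).
have L : ((\int[mu]_x (D x * (h_ k x * cos (c + dotp x xi)))%:E)%E @[k --> \oo] -->
    \int[mu]_x (D x * (h x * cos (c + dotp x xi)))%:E)%E.
  apply: (@dominated_cvg _ _ _ mu setT measurableT _ _ (fun x => M%:E * (`|D x|)%:E)%E) => //.
  - by move=> k; exact: measurable_int (int_bounded (bc k)).
  - move=> x _; apply: cvg_EFin; first exact: nearW.
    by apply: cvgMr; apply: cvgMl; exact: hl.
  - by apply: integrableZl => //; exact: integrable_abse intD.
  - move=> k x _; rewrite -EFinM lee_fin !normrM mulrC ler_wpM2r//.
    rewrite -[leRHS]mulr1; apply: ler_pM => //.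
    by rewrite ler_norml cos_geN1 cos_le1.
have L0 : ((\int[mu]_x (D x * (h_ k x * cos (c + dotp x xi)))%:E)%E @[k --> \oo] --> 0)%E.
  by apply: cvg_near_cst; apply: nearW => k; exact: (ah k).2.
exact: (cvg_unique _ L L0).
Qed.

Let mult_cst a : mult (cst a).
Proof.
split; first by split => //; exists `|a|.
move=> h ah; have := ann_lin a 0 ah ah.
by under eq_fun do rewrite mul0r addr0.
Qed.

Let mult_lin a b h k : mult h -> mult k -> mult (fun x => a * h x + b * k x).
Proof.
move=> [bh ah] [bk ak]; split; first exact: bm_lin.
move=> l al; have := ann_lin a b (ah _ al) (ak _ al).
by under eq_fun do rewrite !mulrA -mulrDl.
Qed.

Let mult_mul h k : mult h -> mult k -> mult (fun x => h x * k x).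
Proof.
move=> [bh ah] [bk ak]; split; first exact: bmM.
move=> l al; have := ah _ (ak _ al).
by under eq_fun do rewrite mulrA.
Qed.

Let mult_exp h j : mult h -> mult (fun x => h x ^+ j).
Proof.
move=> mh; elim: j => [|j IH]; first exact: mult_cst.
by under eq_fun do rewrite exprS; exact: mult_mul.
Qed.

Let mult_lim (h_ : nat -> T -> R) h M : (forall k, mult (h_ k)) ->
  (forall k x, `|h_ k x| <= M) -> (forall x, h_ k x @[k --> \oo] --> h x) ->
  mult h.
Proof.
move=> ah hM hl; split; first by apply: (bm_lim _ hM hl) => k; have [] := ah k.
move=> l al; have [[_ [N lN]] _] := al.
apply: (ann_lim (h_ := fun k x => h_ k x * l x) (M := M * N)).
- by move=> k; exact: (ah k).2.
- by move=> k x; rewrite normrM ler_pM.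
- by move=> x; apply: cvgMl; exact: hl.
Qed.

(** A product of two cosines is a sum of two cosines. *)
Let mult_cos c xi : mult (fun x => cos (c + dotp x xi)).
Proof.
split; first exact: bm_cos.
move=> h [bh h0]; split; first by apply: bmM.
move=> c' xi'.
have E x : D x * (cos (c + dotp x xi) * h x * cos (c' + dotp x xi')) =
    2^-1 * (D x * (h x * cos (c' + c + dotp x (vadd xi' xi)))) +
    2^-1 * (D x * (h x * cos (c' - c + dotp x (vsub xi' xi)))).
  have -> : c' + c + dotp x (vadd xi' xi) = (c' + dotp x xi') + (c + dotp x xi).
    rewrite addrACA; congr (_ + _); rewrite /dotp -big_split/=.
    by apply: eq_bigr => i _; rewrite tnth_mktuple mulrDr.
  have -> : c' - c + dotp x (vsub xi' xi) = (c' + dotp x xi') - (c + dotp x xi).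
    rewrite opprD addrACA; congr (_ + _); rewrite /dotp -sumrB.
    by apply: eq_bigr => i _; rewrite tnth_mktuple mulrBr.
  set a := c' + _; set b := c + _.
  by rewrite cosD cosB; field.
under eq_integral do rewrite E EFinD !EFinM.
have i1 := int_bounded (bmM bh (bm_cos (c' + c) (vadd xi' xi))).
have i2 := int_bounded (bmM bh (bm_cos (c' - c) (vsub xi' xi))).
rewrite integralD//; [|exact: integrableZl|exact: integrableZl].
by rewrite !integralZl// !h0 !mule0 adde0.
Qed.

Let good (A : set T) := mult (\1_A : T -> R).

(** The complement of a countable union is the limit of the finite products of
    the indicators of the complements. *)
Let sigma_good : sigma_algebra setT good.
Proof.
have goodC A : good A -> good (~` A).
  move=> gA; have := mult_lin 1 (-1) (mult_cst 1) gA; rewrite /good.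
  congr mult; apply/funext => x /=.
  rewrite !indicE in_setC; case: (x \in A) => /=; ring.
split.
- by rewrite /good indic0; exact: mult_cst.
- by move=> A gA; rewrite setTD; exact: goodC.
- move=> A gA; rewrite -(setCK (\bigcup_k A k)); apply/goodC.
  rewrite setC_bigcup.
  apply: (mult_lim (h_ := fun K x => \prod_(i < K) \1_(~` A i) x) (M := 1)).
  + move=> K; elim: K => [|K IH].
      by under eq_fun do rewrite big_ord0; exact: mult_cst.
    under eq_fun do rewrite big_ord_recr/=; apply: mult_mul => //.
    exact: goodC.
  + move=> K x; rewrite ger0_norm; last by apply: prodr_ge0 => i _; rewrite indicE.
    by apply: prodr_ile1 => i _; rewrite indicE ler0n/=; case: (_ \in _).
  + move=> x; have [Ax|/existsNP[k /not_implyP[_ Ak]]] := pselect ((\bigcap_k ~` A k) x).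
      apply: cvg_near_cst; apply: nearW => K.
      rewrite indicE mem_set// big1// => i _.
      by rewrite indicE mem_set//; exact: Ax.
    apply: cvg_near_cst; exists k.+1 => // K /= kK.
    rewrite [RHS]indicE memNset; last by move=> /(_ k I).
    by rewrite (bigD1 (Ordinal kK))//= indicE memNset ?mul0r.
Qed.

(** The condition [0 < m x] says that [(1 - m x) / 2], which lies in [0, 1], is
    below [2^-1]; its indicator is the limit of polynomials in [m]. *)
Let good_pos m : mult m -> (forall x, `|m x| <= 1) -> good [set x | 0 < m x].
Proof.
move=> mm m1.
have u01 x : 0 <= 2^-1 + - 2^-1 * m x <= 1.
  by have := m1 x; rewrite ler_norml => /andP[a b]; apply/andP; split; lra.
apply: (mult_lim (h_ := fun k x => threshold k (2^-1 + - 2^-1 * m x)) (M := 1)).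
- move=> k; apply: mult_exp.
  have := mult_lin 1 (-1) (mult_cst 1)
    (mult_exp k (mult_lin 2^-1 (- 2^-1) (mult_cst 1) mm)).
  congr mult; apply/funext => x /=.
  by rewrite mul1r mulr1 mulN1r.
- by move=> k x; have /andP[h0 h1] := threshold01 k (u01 x); rewrite ger0_norm.
- move=> x; have := cvg_threshold (u01 x).
  rewrite indicE (_ : (_ < _) = (x \in [set x | 0 < m x])) //.
  apply/idP/idP; rewrite inE/=; lra.
Qed.

(** Trigonometric multipliers are periodic, but [sin ((x_i - c) / L)] has the
    sign of [x_i - c] for all [L] large enough, depending on [x]. *)
Let good_coord (i : 'I_n) (c : R) : good [set x | c < tnth x i].
Proof.
have [good0 goodC goodU] := sigma_good.
pose B (L : nat) := [set x : T | 0 < sin ((tnth x i - c) / L.+1%:R)].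
have gB L : good (B L).
  pose e := [tuple (if j == i then L.+1%:R^-1 else 0) | j < n] : T.
  have E x : sin ((tnth x i - c) / L.+1%:R) =
     cos (- (c / L.+1%:R) - pi / 2 + dotp x e).
    rewrite /dotp (bigD1 i)//= big1 ?addr0; last first.
      by move=> j ji; rewrite tnth_mktuple (negbTE ji) mulr0.
    rewrite tnth_mktuple eqxx.
    rewrite [X in cos X](_ : _ = (tnth x i - c) / L.+1%:R - pi / 2); last by ring.
    by rewrite cosB cos_pihalf sin_pihalf mulr0 add0r mulr1.
  rewrite (_ : B L = [set x | 0 < cos (- (c / L.+1%:R) - pi / 2 + dotp x e)]).
    apply: good_pos => [|x]; first exact: mult_cos.
    by rewrite ler_norml cos_geN1 cos_le1.
  by apply/seteqP; split => x; rewrite /B/= E.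
have -> : [set x : T | c < tnth x i] = \bigcup_N \bigcap_L B (N + L)%N.
  apply/seteqP; split => x /=.
    move=> cx; exists (Num.truncn (tnth x i - c)) => // L _; rewrite /B/=.
    apply: sin_gt0_pi; rewrite divr_gt0 ?subr_gt0 ?ltr0n//=.
    apply: (@lt_le_trans _ _ 1); last by have := @pi_ge2 R; lra.
    rewrite ltr_pdivrMr ?ltr0n// mul1r (lt_le_trans (truncnS_gt _))//.
    by rewrite ler_nat ltnS leq_addr.
  move=> [N _ hN]; rewrite ltNge; apply/negP => xc.
  have := hN (Num.truncn (c - tnth x i)) I; rewrite /B/= ltNge => /negP; apply.
  set d := _%:R; rewrite -oppr_ge0 -sinN -mulNr opprB.
  apply: sin_ge0_pi; rewrite divr_ge0 ?subr_ge0 ?ler0n//=.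
  apply: (@le_trans _ _ 1); last by have := @pi_ge2 R; lra.
  rewrite ler_pdivrMr ?ltr0n// mul1r (le_trans (ltW (truncnS_gt _)))//.
  by rewrite ler_nat ltnS leq_addl.
apply/goodU => N; rewrite -(setCK (\bigcap_L _)) -setTD; apply/goodC.
rewrite setC_bigcap; apply/goodU => L; rewrite -setTD; exact/goodC.
Qed.

Let measurable_good (A : set T) : measurable A -> good A.
Proof.
move=> mA; rewrite -(sigma_algebra_id sigma_good).
have : measurable_fun setT (idfun : g_sigma_algebraType good -> T).
  apply/measurable_fun_tnthP => i.
  apply: (measurability _ (RGenOInfty.measurableE R)) => _ [_ [c ->] <-].
  rewrite setTI; apply: sub_sigma_algebra.
  have := good_coord i c; congr good; apply/seteqP; split => x /=;
    by rewrite in_itv/= andbT.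
by move=> /(_ measurableT A mA); rewrite setTI.
Qed.

(** Every measurable set has an indicator that is a multiplier, because these
    sets form a sigma-algebra that contains the half-spaces. Applied to the
    function 1 and at frequency 0, this says that the integral of [D] over every
    measurable set is 0. *)
Lemma fourier_eq0_ae : ae_eq mu setT (EFin \o D) (cst 0%E).
Proof.
apply: (integral_ae_eq measurableT intD) => // A _ mA.
rewrite integral0.
have ann1 : ann (cst 1).
  split; first by split => //; exists `|1|.
  by move=> c xi; under eq_integral do rewrite mul1r; exact: fourierD0.
have [_ /(_ 0 [tuple 0 | i < n])] := (measurable_good mA).2 _ ann1.
rewrite integral_mkcond => h; rewrite -[RHS]h; apply: eq_integral => x _.
rewrite patchE indicE /dotp big1 ?addr0 ?cos0; last first.
  by move=> i _; rewrite tnth_mktuple mulr0.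
by case: (x \in A) => /=; rewrite !mulr1 ?mulr0.
Qed.

End uniqueness.

(** * Gaussian mixtures and subordination *)
Section shells.
Context (R : realType).
Local Notation mu := (@lebesgue_measure R).

(** Each shell [j <= |u| < j + 1] is a union of two intervals of length 1. *)
Lemma integral_le_shells (phi : R -> \bar R) (a : nat -> \bar R) :
  measurable_fun [set: R] phi -> (forall u, 0 <= phi u)%E ->
  (forall j, 0 <= a j)%E ->
  (forall j (u : R), (j%:R <= `|u| < j.+1%:R)%R -> (phi u <= a j)%E) ->
  (\int[mu]_u phi u <= \sum_(j <oo) (2%:E * a j))%E.
Proof.
move=> mphi phi0 a0 pa.
pose J (j : nat) : set R := [set u | j%:R <= `|u| < j.+1%:R].
have mJ j : measurable (J j).
  rewrite (_ : J j = setT `&` (@Num.norm R R) @^-1` `[j%:R, j.+1%:R[%classic).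
    exact: normr_measurable.
  by rewrite setTI; apply/seteqP; split => u; rewrite /J /= in_itv.
have JT : \bigcup_j J j = setT.
  apply/seteqP; split => // u _; exists (Num.truncn `|u|) => //=.
  exact: truncn_itv.
have tJ : trivIset setT J.
  apply/trivIsetP => i j _ _ ij; apply/seteqP; split => // u [Ji Jj].
  by move: ij; rewrite -(truncn_def Ji) -(truncn_def Jj) eqxx.
rewrite -JT ge0_integral_bigcup//; last by rewrite JT.
apply: lee_nneseries => [j _ _|j _].
  by apply: integral_ge0 => u _; exact: phi0.
apply: (@le_trans _ _ (\int[mu]_(u in J j) (cst (a j)) u)%E).
  apply: ge0_le_integral => //.
  - exact: mJ.
  - exact: measurable_funTS.
  - by move=> u Ju; exact: pa.
rewrite integral_cst; last exact: mJ.
rewrite muleC lee_wpmul2r//.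
have JS : J j `<=` [set` `[- j.+1%:R, - j%:R]] `|` [set` `[j%:R, j.+1%:R]].
  move=> u /= /andP[h1 h2]; rewrite !in_itv/=.
  by have [u0|u0] := leP 0 u; [right|left]; move: h1 h2;
    [rewrite ger0_norm//|rewrite ltr0_norm//]; lra.
apply: (@le_trans _ _ (mu ([set` `[- j.+1%:R, - j%:R]] `|` [set` `[j%:R, j.+1%:R]]))).
  by apply: le_measure => //; rewrite inE; [exact: mJ|exact: measurableU].
apply: (le_trans (measureU2 _ _ _)) => //.
rewrite /= !lebesgue_measure_itv/= !lte_fin ltrN2 ltr_nat ltnSn -!EFinD lee_fin.
rewrite -natr1; lra.
Qed.

Lemma nneseries_geometric_lty (c q : R) : 0 <= c -> 0 <= q < 1 ->
  (\sum_(j <oo) (c * q ^+ j)%:E < +oo)%E.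
Proof.
move=> c0 /andP[q0 q1].
rewrite (_ : limn _ = (c * (1 - q)^-1)%:E) ?ltry//.
apply/cvg_lim => //.
under eq_fun do rewrite sumEFin.
apply: cvg_EFin; first exact: nearW.
rewrite /comp/=; have := @cvg_geometric_series _ c q.
by rewrite ger0_norm// => /(_ q1).
Qed.

End shells.

Section subordination.
Context (R : realType) (s : R) (s0 : 0 < s).
Local Notation mu := (@lebesgue_measure R).

(** Half of the integrand of the Gamma function at [s / 2], in the variable [u]
    with [t = e^(2 u)]; in this variable the dilations of [t] are translations. *)
Definition weight (u : R) : R := expR (s * u) * expR (- expR (2 * u)).

Lemma weight_ge0 u : 0 <= weight u.
Proof. by rewrite mulr_ge0 ?expR_ge0. Qed.

Lemma measurable_weight : measurable_fun setT weight.
Proof.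
have mexp (k : R) : measurable_fun setT (fun u : R => expR (k * u)).
  by apply: measurableT_comp => //; exact: measurable_funM.
apply: measurable_funM => //; apply: measurableT_comp => //.
exact: measurableT_comp.
Qed.

Lemma weight_le :
  exists C, 0 <= C /\ forall u, weight u <= C * expR (- (s * `|u|)).
Proof.
pose k := (Num.truncn s).+1.
have sk : s <= k%:R by exact/ltW/truncnS_gt.
have C1 : 1 <= k`!%:R :> R by rewrite ler1n fact_gt0.
exists k`!%:R; split => // u.
have [u0|u0] := leP 0 u.
  rewrite ger0_norm// /weight.
  (* For [u >= 0] the double exponential decay beats every [e^(k * u)]; the
     exponential series at [e^(2 u)] up to order [k >= s] is enough. *)
  have h : expR (2 * u) ^+ k / k`!%:R <= expR (expR (2 * u)).
    apply: le_trans (expR_ge1Dxn (Num.truncn s) (expR_ge0 _)).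
    by rewrite lerDr.
  rewrite (expRN (expR _)) ler_pdivrMr ?expR_gt0//.
  apply: (@le_trans _ _ (k`!%:R * expR (- (s * u)) * (expR (2 * u) ^+ k / k`!%:R))).
    rewrite [leRHS](_ : _ = expR (- (s * u)) * expR (2 * u) ^+ k); last first.
      by field; rewrite pnatr_eq0 -lt0n fact_gt0.
    rewrite -expRM_natl -expRD ler_expR.
    by have := ler_wpM2r u0 sk; lra.
  by rewrite ler_wpM2l// mulr_ge0// expR_ge0.
rewrite ltr0_norm// mulrN opprK /weight mulrC ler_wpM2r ?expR_ge0//.
by apply: le_trans C1; rewrite -expR0 ler_expR oppr_le0 expR_ge0.
Qed.

(** Half of the Gamma function at [s / 2]. *)
Definition Gam : R := fine (\int[mu]_u (weight u)%:E).

Lemma integral_weight : (\int[mu]_u (weight u)%:E = Gam%:E)%E.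
Proof.
rewrite /Gam fineK// ge0_fin_numE; last first.
  by apply: integral_ge0 => u _; rewrite lee_fin weight_ge0.
have [C [C0 HC]] := weight_le.
apply: (@le_lt_trans _ _ (\sum_(j <oo) (2%:E * (C * expR (- s) ^+ j)%:E))%E).
  apply: integral_le_shells.
  - by apply/measurable_EFinP; exact: measurable_weight.
  - by move=> u; rewrite lee_fin weight_ge0.
  - by move=> j; rewrite lee_fin mulr_ge0// exprn_ge0// expR_ge0.
  - move=> j u /andP[ju _]; rewrite lee_fin.
    apply: (le_trans (HC u)); rewrite ler_wpM2l// -expRM_natl ler_expR.
    by rewrite mulrN lerN2 mulrC ler_wpM2l// ltW.
under eq_eseriesr do rewrite -EFinM mulrA.
apply: nneseries_geometric_lty; first by rewrite mulr_ge0.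
by rewrite expR_ge0/= expR_lt1 oppr_lt0.
Qed.

Lemma Gam_gt0 : 0 < Gam.
Proof.
rewrite -lte_fin -integral_weight.
have m01 : measurable [set` `[0, 1 : R]] by [].
apply: (@lt_le_trans _ _ (\int[mu]_(u in `[0%R, 1%R]) (cst (expR (- expR 2))%:E) u)%E).
  rewrite integral_cst//= lebesgue_measure_itv/= lte_fin ltr01 oppr0 adde0 mule1.
  by rewrite lte_fin expR_gt0.
apply: (@le_trans _ _ (\int[mu]_(u in `[0%R, 1%R]) (weight u)%:E)%E).
  apply: ge0_le_integral => //.
  - by move=> u _; rewrite lee_fin expR_ge0.
  - by apply/measurable_EFinP/measurable_funTS; exact: measurable_weight.
  - move=> u; rewrite /= in_itv/= => /andP[u0 u1]; rewrite lee_fin /weight.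
    rewrite -[leLHS]mul1r ler_pM ?expR_ge0//.
      by rewrite -expR0 ler_expR mulr_ge0// ltW.
    by rewrite ler_expR lerN2 ler_expR; lra.
apply: ge0_subset_integral => //.
- by apply/measurable_EFinP; exact: measurable_weight.
- by move=> u _; rewrite lee_fin weight_ge0.
Qed.

(** The weight at [u + a] with [e^(2 a) = 1 + A] is
    [(1 + A)^(s / 2)] times the integrand. *)
Lemma integral_weight_exp (A : R) : 0 <= A ->
  (\int[mu]_u (weight u * expR (- (expR (2 * u) * A)))%:E =
   (Gam * (1 + A) `^ (- s / 2))%:E)%E.
Proof.
move=> A0.
have A1 : 0 < 1 + A by rewrite ltr_wpDr.
pose a := ln (1 + A) / 2.
have aE : expR (2 * a) = 1 + A by rewrite /a mulrC divfK// lnK.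
have -> : (1 + A) `^ (- s / 2) = expR (- (s * a)).
  by rewrite /powR gt_eqF// /a; congr expR; ring.
rewrite mulrC EFinM -integral_weight.
rewrite -(ge0_integral_shift a (f := fun u => (weight u)%:E)); last 2 first.
- by apply/measurable_EFinP; exact: measurable_weight.
- by move=> u; rewrite lee_fin weight_ge0.
rewrite -ge0_integralZlT; last 3 first.
- apply/measurable_EFinP; apply: (measurableT_comp (f := weight)).
    exact: measurable_weight.
  exact: measurable_funD.
- by move=> u; rewrite lee_fin weight_ge0.
- by rewrite lee_fin expR_ge0.
apply: eq_integral => u _; rewrite -EFinM; congr (_%:E).
rewrite /weight (mulrDr 2) (expRD (2 * u)) aE mulrDr.
rewrite -!expRD; congr expR; ring.
Qed.

Section mixture.
Variable n : nat.
Local Notation T := (n.-tuple R).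
Local Notation lam := (lebesgueT R n).

(** Chosen so that [exp (- e^(2 u) |xi|^2)] is the Fourier transform of
    [heat (width u)]. *)
Definition width (u : R) : R := Num.sqrt 2 * expR u.

Lemma width_gt0 u : 0 < width u.
Proof. by rewrite mulr_gt0 ?expR_gt0// sqrtr_gt0. Qed.

Lemma width2 u : width u ^+ 2 = 2 * expR (2 * u).
Proof. by rewrite /width exprMn sqr_sqrtr// expRM_natl. Qed.

Lemma normal_pdf_width (u t : R) : normal_pdf 0 (width u) t =
  (Num.sqrt (4 * pi))^-1 * expR (- u) * expR (- (t ^+ 2) * expR (- (2 * u)) / 4).
Proof.
rewrite normal_pdfE ?gt_eqF ?width_gt0// /normal_fun subr0; congr (_ * _).
  rewrite /normal_peak width2 -(mulr_natl (_ * pi)).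
  rewrite (_ : 2 * _ = (4 * pi) * expR u ^+ 2); last first.
    by rewrite -expRM_natl; ring.
  rewrite sqrtrM ?mulr_ge0 ?pi_ge0// sqrtr_sqr ger0_norm ?expR_ge0//.
  by rewrite invfM expRN.
congr expR; rewrite width2 expRN -(mulr_natl (2 * _)).
by field; rewrite gt_eqF ?expR_gt0.
Qed.

Lemma measurable_heat_width :
  measurable_fun setT (fun p : R * T => heat (width p.1) p.2).
Proof.
rewrite /heat; apply: measurable_prod => i _.
under eq_fun do rewrite normal_pdf_width.
have mt : measurable_fun setT (fun p : R * T => tnth p.2 i).
  by apply: (measurableT_comp (f := fun x : T => tnth x i)) => //; exact: measurable_tnth.
apply: measurable_funM; first apply: measurable_funM => //.
  by apply: measurableT_comp => //; exact: measurableT_comp.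
apply: measurableT_comp => //; apply: measurable_funM => //.
apply: measurable_funM; first by apply: measurableT_comp => //; exact: measurable_funX.
apply: measurableT_comp => //; apply: measurableT_comp => //.
exact: measurable_funM.
Qed.

Definition mixture (x : T) : \bar R :=
  (\int[mu]_u (weight u * heat (width u) x)%:E)%E.

Let H (p : R * T) : R := weight p.1 * heat (width p.1) p.2.

Let mH : measurable_fun setT H.
Proof.
apply: measurable_funM; last exact: measurable_heat_width.
by apply: measurableT_comp => //; exact: measurable_weight.
Qed.

Let H0 p : 0 <= H p.
Proof. by rewrite mulr_ge0 ?weight_ge0 ?heat_ge0. Qed.

Let mHx (x : T) : measurable_fun [set: R] (fun u => weight u * heat (width u) x).
Proof. exact: (measurableT_comp mH (pair2_measurable x)). Qed.

Let intH (k : R * T -> R) : measurable_fun setT k -> (forall p, `|k p| <= 1) ->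
  (mu \x lam)%E.-integrable setT (fun p => (H p * k p)%:E).
Proof.
move=> mk k1.
apply/integrable12ltyP.
  by apply/measurable_EFinP; exact: measurable_funM.
apply: (@le_lt_trans _ _ (\int[mu]_u (weight u)%:E)%E); last first.
  by rewrite integral_weight ltry.
apply: ge0_le_integralT.
- apply: (measurable_fun_fubini_tonelli_F (fun p => `|(H p * k p)%:E|)%E) => //.
  by apply: measurableT_comp => //; apply/measurable_EFinP; exact: measurable_funM.
- by apply/measurable_EFinP; exact: measurable_weight.
- by move=> u; exact: integral_ge0.
- move=> u; apply: (@le_trans _ _ (\int[lam]_x ((weight u)%:E * (heat (width u) x)%:E))%E).
    apply: ge0_le_integralT => //.
    + apply: measurableT_comp => //; apply/measurable_EFinP.
      apply: (measurableT_comp (f := fun p => H p * k p)); first exact: measurable_funM.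
      exact: pair1_measurable.
    + by apply: measurable_funeM; apply/measurable_EFinP; exact: measurable_heat.
    + move=> x; rewrite -EFinM lee_fin normrM (ger0_norm (H0 _)).
      by rewrite ler_piMr ?H0.
  rewrite ge0_integralZlT ?lee_fin ?weight_ge0//.
  - by rewrite integral_heat mule1.
  - by apply/measurable_EFinP; exact: measurable_heat.
  - by move=> x; rewrite lee_fin heat_ge0.
Qed.

Lemma mixture_ge0 x : (0 <= mixture x)%E.
Proof.
by apply: integral_ge0 => u _; rewrite lee_fin mulr_ge0 ?weight_ge0 ?heat_ge0.
Qed.

Lemma measurable_mixture : measurable_fun setT mixture.
Proof.
apply: (measurable_fun_fubini_tonelli_G (m1 := mu) (fun p => (H p)%:E)).
- exact/measurable_EFinP.
- by move=> p; rewrite lee_fin.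
Qed.

Lemma integrable_mixture : lam.-integrable setT mixture.
Proof.
apply/integrableP; split; first exact: measurable_mixture.
under eq_integral do rewrite gee0_abs ?mixture_ge0//.
rewrite -(fubini_tonelli (m1 := mu) (m2 := lam) (fun p => (H p)%:E)); last 2 first.
- exact/measurable_EFinP.
- by move=> p; rewrite lee_fin.
apply: (@le_lt_trans _ _ (\int[mu]_u (weight u)%:E)%E); last first.
  by rewrite integral_weight ltry.
rewrite le_eqVlt; apply/orP; left; apply/eqP; apply: eq_integral => u _.
under eq_integral do rewrite /H /= EFinM.
rewrite ge0_integralZlT ?lee_fin ?weight_ge0//.
- by rewrite integral_heat mule1.
- by apply/measurable_EFinP; exact: measurable_heat.
- by move=> x; rewrite lee_fin heat_ge0.
Qed.

Lemma integrable_fine_mixture : lam.-integrable setT (EFin \o (fine \o mixture)).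
Proof.
apply: (le_integrable measurableT _ _ integrable_mixture).
  apply/measurable_EFinP; apply: measurableT_comp => //.
  exact: measurable_mixture.
move=> x _ /=; rewrite ger0_norm ?fine_ge0 ?mixture_ge0//.
rewrite gee0_abs ?mixture_ge0//.
by case: (mixture x) (mixture_ge0 x) => // _; rewrite leey.
Qed.

(** Exchanging the integrals reduces this to the Fourier transform of a single
    Gaussian and to [integral_weight_exp]. The mixture may be infinite on a null
    set, which [fine] ignores. *)
Lemma integral_mixture_cos (c : R) (eta : T) :
  (\int[lam]_x (fine (mixture x) * cos (c + dotp x eta))%:E =
   (Gam * (1 + dotp eta eta) `^ (- s / 2) * cos c)%:E)%E.
Proof.
pose k (p : R * T) := cos (c + dotp p.2 eta).
have mk : measurable_fun setT k.
  apply: (measurableT_comp (f := fun x : T => cos (c + dotp x eta))) => //.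
  exact: measurable_cos_dotp.
have k1 p : `|k p| <= 1 by rewrite ler_norml cos_geN1 cos_le1.
have iHk := intH mk k1.
have e1 : (\int[lam]_x fubini_G mu (fun p => (H p * k p)%:E) x =
   \int[lam]_x (fine (mixture x) * cos (c + dotp x eta))%:E)%E.
  apply: ae_eq_integral => //.
  - exact: measurable_fubini_G iHk.
  - apply/measurable_EFinP; apply: measurable_funM; last exact: measurable_cos_dotp.
    by apply: measurableT_comp => //; exact: measurable_mixture.
  - have := integrable_ae measurableT integrable_mixture.
    apply: filterS => x /(_ I) fx _; rewrite /fubini_G EFinM fineK//.
    under eq_integral do rewrite /k /= EFinM.
    rewrite integralZr//.
    apply/integrableP; split.
      by apply/measurable_EFinP; exact: mHx.
    under eq_integral do rewrite gee0_abs ?lee_fin ?H0//.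
    by rewrite -ge0_fin_numE ?mixture_ge0.
rewrite -e1 integral21_prod_meas1// -integral12_prod_meas1//.
transitivity (\int[mu]_u ((cos c)%:E *
   (weight u * expR (- (expR (2 * u) * dotp eta eta)))%:E))%E.
  apply: eq_integral => u _; rewrite /fubini_F /H /k /=.
  under eq_integral do rewrite -mulrA EFinM.
  rewrite integralZl//; last first.
    apply: (le_integrable measurableT _ _ (integrable_heat n (width u))).
      apply/measurable_EFinP; apply: measurable_funM; first exact: measurable_heat.
      exact: measurable_cos_dotp.
    move=> x _; rewrite /= lee_fin normrM ler_piMr//.
    by rewrite ler_norml cos_geN1 cos_le1.
  rewrite integral_heat_cos ?width_gt0// -!EFinM; congr (_%:E).
  rewrite width2 (_ : - _ / 2 = - (expR (2 * u) * dotp eta eta)); last by field.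
  by ring.
have d0 : 0 <= dotp eta eta by apply: sumr_ge0 => i _; rewrite -expr2 sqr_ge0.
rewrite integralZl//; last first.
  apply/integrableP; split.
    apply/measurable_EFinP; apply: measurable_funM; first exact: measurable_weight.
    apply: measurableT_comp => //; apply: measurableT_comp => //.
    by apply: measurable_funM => //; exact: measurableT_comp.
  under eq_integral do rewrite gee0_abs ?lee_fin ?mulr_ge0 ?weight_ge0 ?expR_ge0//.
  by rewrite integral_weight_exp// ltry.
by rewrite integral_weight_exp// -EFinM; congr (_%:E); ring.
Qed.

Lemma normal_pdf_le (a b t : R) : 0 < a -> a <= b ->
  normal_pdf 0 a t <= b / a * normal_pdf 0 b t.
Proof.
move=> a0 ab; have b0 : 0 < b by exact: lt_le_trans ab.
rewrite !normal_pdfE ?gt_eqF// /normal_fun !subr0.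
have peakE x : 0 < x -> normal_peak x = x^-1 * (Num.sqrt (pi *+ 2))^-1 :> R.
  move=> x0; rewrite /normal_peak -mulrnAr sqrtrM ?sqr_ge0// sqrtr_sqr.
  by rewrite ger0_norm ?(ltW x0)// invfM.
rewrite !peakE// [leRHS](_ : _ = a^-1 * (Num.sqrt (pi *+ 2))^-1 *
    expR (- t ^+ 2 / (b ^+ 2 *+ 2))); last first.
  by rewrite !mulrA (mulrAC b a^-1) mulfV ?mul1r// gt_eqF.
rewrite ler_wpM2l//.
  by rewrite mulr_ge0 ?invr_ge0 ?sqrtr_ge0// ltW.
rewrite ler_expR !mulNr lerN2 ler_wpM2l ?sqr_ge0//.
rewrite lef_pV2 ?posrE ?mulrn_wgt0 ?exprn_gt0// lerMn2r/=.
by rewrite ler_pXn2r ?nnegrE ?(ltW a0) ?(ltW b0).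
Qed.

Lemma heat_le (a b : R) (x : T) : 0 < a -> a <= b ->
  heat a x <= (b / a) ^+ n * heat b x.
Proof.
move=> a0 ab; rewrite /heat -[X in _ ^+ X](card_ord n) -prodr_const -big_split/=.
by apply: ler_prod => i _; rewrite normal_pdf_ge0 normal_pdf_le.
Qed.

(** A Gaussian is dominated by a wider one, at the cost of the ratio of the
    peaks, and the widths at [u] and [v] differ at most by a factor [e]. *)
Lemma heat_width_le (u v : R) (x : T) : u <= v <= u + 1 ->
  heat (width u) x <= expR 1 ^+ n * heat (width v) x.
Proof.
move=> /andP[uv vu].
have wuv : width u <= width v by rewrite ler_pM2l ?sqrtr_gt0// ler_expR.
apply: (le_trans (heat_le x (width_gt0 u) wuv)).
rewrite ler_wpM2r ?heat_ge0// lerXn2r ?nnegrE ?expR_ge0 ?divr_ge0 ?(ltW (width_gt0 _))//.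
rewrite ler_pdivrMr ?width_gt0// /width mulrCA ler_pM2l ?sqrtr_gt0//.
by rewrite -expRD ler_expR addrC.
Qed.

(** On the shell [j <= |u| < j + 1] the weight is at most [C e^(- s j)], and
    [heat (width u)] is at most [e^n] times its value at the right end of the
    half of the shell in which [u] lies: [j + 1] if [u >= 0], and [- j] if
    [u < 0]. *)
Lemma mixture_le : exists C, 0 <= C /\ forall x,
  (mixture x <= \sum_(j <oo) (C * expR (- s) ^+ j *
     (heat (width j.+1%:R) x + heat (width (- j%:R)) x))%:E)%E.
Proof.
have [C [C0 HC]] := weight_le.
exists (2 * (C * expR 1 ^+ n)); split.
  by rewrite !mulr_ge0// exprn_ge0// expR_ge0.
move=> x.
pose a j : \bar R := (C * expR 1 ^+ n * expR (- s) ^+ j *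
     (heat (width j.+1%:R) x + heat (width (- j%:R)) x))%:E.
rewrite [leRHS](_ : _ = \sum_(j <oo) (2%:E * a j))%E; last first.
  by apply: eq_eseriesr => j _; rewrite /a -EFinM; congr (_%:E); ring.
apply: integral_le_shells.
- by apply/measurable_EFinP; exact: mHx.
- by move=> u; rewrite lee_fin (H0 (u, x)).
- move=> j; rewrite lee_fin mulr_ge0 ?addr_ge0 ?heat_ge0// !mulr_ge0//;
    by rewrite exprn_ge0// expR_ge0.
- move=> j u /andP[ju uj]; rewrite lee_fin.
  have hw : weight u <= C * expR (- s) ^+ j.
    apply: (le_trans (HC u)); rewrite ler_wpM2l// -expRM_natl ler_expR.
    by rewrite mulrN lerN2 mulrC ler_wpM2l// ltW.
  have hh : heat (width u) x <= expR 1 ^+ n *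
      (heat (width j.+1%:R) x + heat (width (- j%:R)) x).
    have e0 : 0 <= expR 1 ^+ n :> R by rewrite exprn_ge0// expR_ge0.
    have h1 := @heat_width_le u j.+1%:R x.
    have h2 := @heat_width_le u (- j%:R) x.
    move: ju uj; have [u0|u0] := leP 0 u.
      rewrite ger0_norm// => ju uj.
      apply: (le_trans (h1 _)); first by rewrite (ltW uj) -natr1 lerD2r ju.
      by rewrite ler_wpM2l// lerDl heat_ge0.
    rewrite ltr0_norm// => ju; rewrite -natr1 => uj.
    apply: (le_trans (h2 _)); first by rewrite lerNr ju/= lerNl opprD lerBlDr ltW.
    by rewrite ler_wpM2l// lerDr heat_ge0.
  apply: (le_trans (ler_pM _ _ hw hh)); rewrite ?weight_ge0 ?heat_ge0//.
  by rewrite le_eqVlt; apply/orP; left; apply/eqP; ring.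
Qed.

End mixture.

End subordination.

(** * Complex-valued integrands *)
Section complex_measurability.
Context (R : realType).
Local Notation normc := (@ComplexField.Normc.normc R).

Lemma normc_real (a : R) : normc (a%:C)%C = `|a|.
Proof. by rewrite /= expr0n/= addr0 sqrtr_sqr. Qed.

Lemma normc_ge0 (z : R[i]) : 0 <= normc z.
Proof. by case: z => a b; exact: sqrtr_ge0. Qed.

Lemma normr_Re_le (z : R[i]) : `|complex.Re z| <= normc z.
Proof. by case: z => a b /=; rewrite -sqrtr_sqr ler_wsqrtr// lerDl sqr_ge0. Qed.

Lemma normr_Im_le (z : R[i]) : `|complex.Im z| <= normc z.
Proof. by case: z => a b /=; rewrite -sqrtr_sqr ler_wsqrtr// lerDr sqr_ge0. Qed.

Lemma normc_le (z : R[i]) : normc z <= `|complex.Re z| + `|complex.Im z|.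
Proof.
case: z => a b /=; rewrite -[leRHS]ger0_norm ?addr_ge0// -sqrtr_sqr ler_wsqrtr//.
rewrite -(real_normK (num_real a)) -(real_normK (num_real b)) sqrrD.
by rewrite lerD2r lerDl mulrn_wge0// mulr_ge0.
Qed.

Context d (T : measurableType d).

Lemma cmeasurableM (h k : T -> R[i]) : cmeasurable h -> cmeasurable k ->
  cmeasurable (fun x => h x * k x).
Proof.
move=> [rh ih] [rk ik]; split.
  rewrite (_ : (fun x => _) = (fun x => complex.Re (h x) * complex.Re (k x) -
      complex.Im (h x) * complex.Im (k x))).
    by apply: measurable_funB; exact: measurable_funM.
  by apply/funext => x; case: (h x) => a b; case: (k x).
rewrite (_ : (fun x => _) = (fun x => complex.Re (h x) * complex.Im (k x) +
    complex.Im (h x) * complex.Re (k x))).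
  by apply: measurable_funD; exact: measurable_funM.
by apply/funext => x; case: (h x) => a b; case: (k x).
Qed.

Lemma cmeasurable_comp d' (U : measurableType d') (phi : U -> T) (h : T -> R[i]) :
  measurable_fun setT phi -> cmeasurable h -> cmeasurable (h \o phi).
Proof.
move=> mphi [rh ih].
by split; [exact: (measurableT_comp rh)|exact: (measurableT_comp ih)].
Qed.

Lemma measurable_normc (h : T -> R[i]) : cmeasurable h ->
  measurable_fun setT (fun x => normc (h x)).
Proof.
move=> [rh ih].
rewrite (_ : (fun x => _) = (fun x => ((complex.Re (h x)) ^+ 2 +
    (complex.Im (h x)) ^+ 2) `^ 2^-1)).
  apply: (measurableT_comp (measurable_powR _)).
  by apply: measurable_funD; exact: measurable_funX.
apply/funext => x; rewrite powR12_sqrt ?addr_ge0 ?sqr_ge0//.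
by case: (h x).
Qed.

(** The sections may fail to be integrable, but the integral is the difference
    of the integrals of the positive and negative parts, and both are measurable
    by Tonelli's theorem. *)
Lemma measurable_Rintegral d' (U : measurableType d')
    (m : {sigma_finite_measure set U -> \bar R}) (h : T * U -> R) :
  measurable_fun setT h -> measurable_fun setT (fun x => \int[m]_y h (x, y)).
Proof.
move=> mh; rewrite /Rintegral.
apply: (measurableT_comp (f := fine)) => //.
under eq_fun do rewrite integralE.
have mh' : measurable_fun setT (EFin \o h) by exact/measurable_EFinP.
apply: emeasurable_funB.
- rewrite (_ : (fun x => _) = fubini_F m ((EFin \o h)^\+)%E).
    apply: measurable_fun_fubini_tonelli_F; first exact: measurable_funepos.
    by move=> p; exact: funepos_ge0.
  by apply/funext => x; apply: eq_integral => y _; rewrite !funeposE.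
- rewrite (_ : (fun x => _) = fubini_F m ((EFin \o h)^\-)%E).
    apply: measurable_fun_fubini_tonelli_F; first exact: measurable_funeneg.
    by move=> p; exact: funeneg_ge0.
  by apply/funext => x; apply: eq_integral => y _; rewrite !funenegE.
Qed.

(** When the integral of [h] is infinite, its real value is 0. *)
Lemma normr_Rintegral_le (m : {measure set T -> \bar R}) (h : T -> R) :
  measurable_fun setT h ->
  ((`|\int[m]_x h x|)%:E <= \int[m]_x `|(h x)%:E|)%E.
Proof.
move=> mh; apply: le_trans (le_abse_integral m measurableT _); last exact/measurable_EFinP.
rewrite /Rintegral; case: (\int[m]_x (h x)%:E)%E => [r//||] /=; by rewrite normr0 leey.
Qed.

(** The real and the imaginary part are estimated separately, hence the factor
    2. *)
Lemma normc_cintegral_le (m : {measure set T -> \bar R}) (h : T -> R[i]) :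
  cmeasurable h ->
  ((normc (cintegral m h))%:E <= 2%:E * \int[m]_x (normc (h x))%:E)%E.
Proof.
move=> ch; have [rh ih] := ch.
have mn : measurable_fun setT (fun x => (normc (h x))%:E).
  by apply/measurable_EFinP; exact: measurable_normc.
apply: (@le_trans _ _ ((`|\int[m]_x complex.Re (h x)|)%:E +
    (`|\int[m]_x complex.Im (h x)|)%:E)%E).
  by rewrite -EFinD lee_fin; exact: normc_le.
rewrite (_ : 2%:E * _ = \int[m]_x (normc (h x))%:E + \int[m]_x (normc (h x))%:E)%E; last first.
  have -> : 2%:E = (1%:E + 1%:E)%E :> \bar R by [].
  by rewrite ge0_muleDl ?lee_fin// mul1e.
apply: leeD.
- apply: (le_trans (normr_Rintegral_le m rh)); apply: ge0_le_integralT => //.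
  + by apply: measurableT_comp => //; exact/measurable_EFinP.
  + by move=> x; rewrite /= lee_fin; exact: normr_Re_le.
- apply: (le_trans (normr_Rintegral_le m ih)); apply: ge0_le_integralT => //.
  + by apply: measurableT_comp => //; exact/measurable_EFinP.
  + by move=> x; rewrite /= lee_fin; exact: normr_Im_le.
Qed.

End complex_measurability.

(** * Domination of the Bessel kernel by Gaussians *)
Section bessel.
Context (R : realType) (n : nat) (s : R) (s0 : 0 < s).
Variable (G : n.-tuple R -> R) (hG : is_bessel_kernel s G).
Local Notation T := (n.-tuple R).
Local Notation lam := (lebesgueT R n).

Lemma bessel_ge0 x : 0 <= G x. Proof. by have [] := hG. Qed.

Lemma measurable_bessel : measurable_fun setT G.
Proof. by have [_ [[]]] := hG. Qed.

Lemma integrable_bessel : lam.-integrable setT (EFin \o G).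
Proof.
have [_ [_ h] _] := hG; apply/integrableP; split.
  by apply/measurable_EFinP; exact: measurable_bessel.
move: h; rewrite /cLnorm Lnorm1; apply: le_lt_trans.
rewrite le_eqVlt; apply/orP; left; apply/eqP; apply: eq_integral => x _ /=.
by rewrite expr0n/= addr0 sqrtr_sqr normr_id.
Qed.

Let integrable_trig (f : T -> R) : measurable_fun setT f -> (forall x, `|f x| <= 1) ->
  lam.-integrable setT (EFin \o (fun x => G x * f x)).
Proof.
move=> mf f1; apply: (le_integrable measurableT _ _ integrable_bessel).
  by apply/measurable_EFinP; apply: measurable_funM => //; exact: measurable_bessel.
by move=> x _ /=; rewrite lee_fin normrM ler_piMr.
Qed.

(** The real and imaginary parts of the Fourier transform give the phases 0 and
    [pi / 2], of which every phase is a linear combination; the frequency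
    [eta / (2 * pi)] removes the normalization. *)
Lemma bessel_fourier (c : R) (eta : T) :
  (\int[lam]_x (G x * cos (c + dotp x eta))%:E =
   ((1 + dotp eta eta) `^ (- s / 2) * cos c)%:E)%E.
Proof.
have [_ _ hF] := hG.
have pi0 : pi != 0 :> R by rewrite gt_eqF// pi_gt0.
have aux1 (p a b : R) : p != 0 -> 2 * p * (a * (b / (2 * p))) = a * b.
  by move=> p0; field.
have aux2 (p a : R) : p != 0 ->
    4 * p ^+ 2 * (a / (2 * p) * (a / (2 * p))) = a * a.
  by move=> p0; field.
pose xi : T := [tuple tnth eta i / (2 * pi) | i < n].
have dE x : 2 * pi * dotp x xi = dotp x eta.
  rewrite /dotp mulr_sumr; apply: eq_bigr => i _; rewrite tnth_mktuple.
  exact: aux1.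
have dE2 : 4 * pi ^+ 2 * dotp xi xi = dotp eta eta.
  rewrite /dotp mulr_sumr; apply: eq_bigr => i _; rewrite tnth_mktuple.
  exact: aux2.
have := hF xi; rewrite dE2 /fourier /cintegral => -[hRe hIm].
have mcos : measurable_fun setT (fun x : T => cos (dotp x eta)).
  by under eq_fun do rewrite -[dotp _ _]add0r; exact: measurable_cos_dotp.
have msin : measurable_fun setT (fun x : T => sin (dotp x eta)).
  under eq_fun do rewrite -[sin _]opprK -cosDpihalf addrC.
  by apply: measurableT_comp => //; exact: measurable_cos_dotp.
have i1 : lam.-integrable setT (EFin \o (fun x => G x * cos (dotp x eta))).
  by apply: integrable_trig => // x; rewrite ler_norml cos_geN1 cos_le1.
have i2 : lam.-integrable setT (EFin \o (fun x => G x * sin (dotp x eta))).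
  by apply: integrable_trig => // x; rewrite ler_norml sin_geN1 sin_le1.
have C : \int[lam]_x (G x * cos (dotp x eta)) = (1 + dotp eta eta) `^ (- s / 2).
  rewrite -hRe; apply: eq_Rintegral => x _ /=.
  by rewrite mul0r subr0 dE cosN.
have S : \int[lam]_x (G x * sin (dotp x eta)) = 0.
  apply: oppr_inj; rewrite oppr0 -hIm -mulN1r -RintegralZl//.
  apply: eq_Rintegral => x _ /=.
  by rewrite mul0r addr0 dE sinN mulN1r mulrN.
rewrite -[LHS]fineK; last first.
  apply: integrable_fin_num => //; apply: integrable_trig.
    exact: measurable_cos_dotp.
  by move=> x; rewrite ler_norml cos_geN1 cos_le1.
congr (_%:E); rewrite -/(Rintegral lam setT (fun x => G x * cos (c + dotp x eta))).
transitivity (\int[lam]_x (cos c * (G x * cos (dotp x eta)) -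
    sin c * (G x * sin (dotp x eta)))).
  by apply: eq_Rintegral => x _; rewrite cosD; ring.
rewrite RintegralB//; [|exact: (integrableZl measurableT (cos c) i1)
  |exact: (integrableZl measurableT (sin c) i2)].
by rewrite !RintegralZl// C S mulr0 subr0 mulrC.
Qed.

(** The mixture and [Gam s * G] are integrable with the same Fourier transform,
    hence equal almost everywhere, and the mixture is at most a series of
    Gaussians everywhere. *)
Lemma bessel_kernel_le : exists C : R, 0 <= C /\
  {ae lam, forall x, ((G x)%:E <= \sum_(j <oo) (C * expR (- s) ^+ j *
     (heat (width j.+1%:R) x + heat (width (- j%:R)) x))%:E)%E}.
Proof.
have [C [C0 HC]] := mixture_le s0 n.
exists ((Gam s)^-1 * C); split.
  by rewrite mulr_ge0// invr_ge0 ltW// Gam_gt0.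
pose D x := Gam s * G x - fine (mixture s x).
have iM := integrable_fine_mixture s0 n.
have intD : lam.-integrable setT (EFin \o D).
  rewrite (_ : _ \o _ = (fun x => (Gam s)%:E * (G x)%:E) \-
      (fun x => (fine (mixture s x))%:E))%E; last first.
    by apply/funext => x; rewrite /D/= EFinB EFinM.
  by apply: integrableB => //; apply: integrableZl => //; exact: integrable_bessel.
have D0 c xi : (\int[lam]_x (D x * cos (c + dotp x xi))%:E = 0)%E.
  have mc := measurable_cos_dotp c xi.
  have c1 x : `|cos (c + dotp x xi)| <= 1 by rewrite ler_norml cos_geN1 cos_le1.
  have i1 := integrable_trig mc c1.
  have i2 : lam.-integrable setT
      (fun x => (fine (mixture s x) * cos (c + dotp x xi))%:E).
    apply: (le_integrable measurableT _ _ iM).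
      apply/measurable_EFinP; apply: measurable_funM => //.
      by apply/measurable_EFinP; exact: measurable_int iM.
    by move=> x _ /=; rewrite lee_fin normrM ler_piMr.
  under eq_integral do rewrite mulrBl -mulrA EFinB EFinM.
  rewrite integralB//; last exact: integrableZl.
  rewrite integralZl// bessel_fourier integral_mixture_cos//.
  by rewrite -EFinM -EFinB; congr (_%:E); ring.
have h1 := fourier_eq0_ae intD D0.
have h2 := integrable_ae measurableT (integrable_mixture s0 n).
apply: filterS2 h1 h2 => x /(_ I) /= [Dx] /(_ I) fx.
have -> : (G x)%:E = ((Gam s)^-1%:E * mixture s x)%E.
  rewrite -(fineK fx) -EFinM; congr (_%:E).
  move: Dx => /eqP; rewrite subr_eq0 => /eqP <-.
  by rewrite mulKf// gt_eqF// Gam_gt0.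
apply: (@le_trans _ _ ((Gam s)^-1%:E * \sum_(j <oo) (C * expR (- s) ^+ j *
     (heat (width j.+1%:R) x + heat (width (- j%:R)) x))%:E)%E).
  by rewrite lee_wpmul2l ?HC// lee_fin invr_ge0 ltW// Gam_gt0.
rewrite -nneseriesZl; last first.
  move=> j _; rewrite lee_fin mulr_ge0 ?addr_ge0 ?heat_ge0// mulr_ge0//.
rewrite le_eqVlt; apply/orP; left; apply/eqP; apply: eq_eseriesr => j _.
by rewrite -EFinM !mulrA.
Qed.

End bessel.

(** * The bilinear potential of nonnegative functions *)
Section root_series.
Context (R : realType).
Local Open Scope ereal_scope.

Lemma poweR_half_sq (x : \bar R) : 0 <= x -> x `^ 2^-1 * x `^ 2^-1 = x.
Proof.
case: x => [r r0||//]; last by rewrite poweRyr ?invr_eq0// mulyy.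
by rewrite poweR_EFin -EFinM powR12_sqrt// -expr2 sqr_sqrtr.
Qed.

Lemma poweR_half_sqr (x : \bar R) : 0 <= x -> (x * x) `^ 2^-1 = x.
Proof. by move=> x0; rewrite poweRM// poweR_half_sq. Qed.

Lemma le_poweR_half (x y : \bar R) : 0 <= x -> x <= y -> x `^ 2^-1 <= y `^ 2^-1.
Proof.
move=> x0 xy; apply: gt0_ler_poweR => //; rewrite in_itv/= leey andbT//.
exact: le_trans xy.
Qed.

(** If [S] is the sum of the roots, then each [x j] is at most [S] times its
    root, so that the sum of the [x j] is at most [S * S]. *)
Lemma poweR_half_nneseries (x : nat -> \bar R) : (forall j, 0 <= x j) ->
  (\sum_(j <oo) x j) `^ 2^-1 <= \sum_(j <oo) x j `^ 2^-1.
Proof.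
move=> x0; set S := \sum_(j <oo) x j `^ 2^-1.
have S0 : 0 <= S by apply: nneseries_ge0 => j _ _; exact: poweR_ge0.
have xS j : x j `^ 2^-1 <= S.
  apply: le_trans (nneseries_lim_ge j.+1 _); last by move=> k _ _; exact: poweR_ge0.
  by rewrite big_nat_recr//= leeDr// sume_ge0// => k _; exact: poweR_ge0.
rewrite -[leRHS]poweR_half_sqr//; apply: le_poweR_half.
  by apply: nneseries_ge0.
have [->|Soo] := eqVneq S +oo; first by rewrite mulyy leey.
have Sf : S \is a fin_num by rewrite ge0_fin_numE// lt_neqAle Soo leey.
rewrite -[X in X * _](fineK Sf) -nneseriesZl; last by move=> j _; exact: poweR_ge0.
apply: lee_nneseries => [j _ _|j _]; first exact: x0.
by rewrite fineK// -[leLHS]poweR_half_sq// lee_wpmul2r// poweR_ge0.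
Qed.

Lemma poweR_half_add (x y : \bar R) : 0 <= x -> 0 <= y ->
  (x + y) `^ 2^-1 <= x `^ 2^-1 + y `^ 2^-1.
Proof.
move=> x0 y0; have px := @poweR_ge0 R x 2^-1; have py := @poweR_ge0 R y 2^-1.
rewrite -[leRHS]poweR_half_sqr ?adde_ge0//; apply: le_poweR_half; first exact: adde_ge0.
rewrite ge0_muleDl// !ge0_muleDr// !poweR_half_sq//.
by rewrite leeD// ?leeDl ?leeDr// mule_ge0.
Qed.

End root_series.

(** The optimal choice is [l = sqrt (B / A)]. If [A] or [B] is 0, letting [l]
    tend to infinity or to 0 gives [X = 0]. *)
Lemma sqr_le_of_scaling (R : realType) (X A B C : R) :
  0 <= X -> 0 <= A -> 0 <= B -> 0 <= C ->
  (forall l, 0 < l -> X <= C * (l * A + l^-1 * B)) ->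
  X ^+ 2 <= 4 * C ^+ 2 * (A * B).
Proof.
move=> X0 A0 B0 C0 h.
have zero : A = 0 \/ B = 0 -> X = 0.
  move=> AB0; apply/eqP; rewrite eq_le X0 andbT leNgt; apply/negP => Xp.
  have CA : 0 < C * A + 1 by rewrite ltr_wpDl// mulr_ge0.
  have CB : 0 < C * B + 1 by rewrite ltr_wpDl// mulr_ge0.
  case: AB0 => E.
    (* This [l] would give [X <= X * (C * B) / (C * B + 1)]. *)
    have := h ((C * B + 1) / X) (divr_gt0 CB Xp).
    rewrite E mulr0 add0r invf_div mulrCA mulrC mulrA ler_pdivlMr//.
    by rewrite mulrDr mulr1 mulrC gerDl leNgt Xp.
  have := h (X / (C * A + 1)) (divr_gt0 Xp CA).
  rewrite E mulr0 addr0 (_ : C * _ = C * A * X / (C * A + 1)); last by ring.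
  rewrite ler_pdivlMr//.
  by rewrite mulrDr mulr1 mulrC gerDl leNgt Xp.
have [A00|An0] := eqVneq A 0.
  by rewrite zero ?expr0n ?mulr_ge0 ?sqr_ge0//; left.
have [B00|Bn0] := eqVneq B 0.
  by rewrite zero ?expr0n ?mulr_ge0 ?sqr_ge0//; right.
have [a a0 EA] : exists2 a, 0 < a & A = a ^+ 2.
  by exists (Num.sqrt A); rewrite ?sqr_sqrtr// sqrtr_gt0 lt_def An0.
have [b b0 EB] : exists2 b, 0 < b & B = b ^+ 2.
  by exists (Num.sqrt B); rewrite ?sqr_sqrtr// sqrtr_gt0 lt_def Bn0.
have := h _ (divr_gt0 b0 a0).
rewrite EA EB (_ : C * _ = 2 * C * (a * b)); last by field; rewrite !gt_eqF.
rewrite (_ : 4 * _ * _ = (2 * C * (a * b)) ^+ 2); last by ring.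
by move=> hX; rewrite lerXn2r ?nnegrE// !mulr_ge0// ltW.
Qed.

Lemma poweR2 (R : realType) (x : \bar R) : (0 <= x)%E -> (x `^ 2 = x * x)%E.
Proof.
case: x => [r r0||//]; last by rewrite poweRyr ?mulyy// pnatr_eq0.
by rewrite poweR_EFin powR_mulrn// -EFinM expr2.
Qed.
Section bilinear_bound.
Context (R : realType) (n : nat) (s : R) (s0 : 0 < s).
Variable (G : n.-tuple R -> R) (hG : is_bessel_kernel s G).
Local Notation T := (n.-tuple R).
Local Notation lam := (lebesgueT R n).

Definition ge0_potential (f g : T -> R) (x : T) : \bar R :=
  (\int[lam]_y (G y * f (vsub x y) * g (vadd x y))%:E)%E.

Lemma ge0_potential_ge0 (f g : T -> R) x :
  (forall x, 0 <= f x) -> (forall x, 0 <= g x) -> (0 <= ge0_potential f g x)%E.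
Proof.
move=> f0 g0; apply: integral_ge0 => y _.
by rewrite lee_fin !mulr_ge0// (bessel_ge0 hG).
Qed.

Lemma measurable_ge0_potential (f g : T -> R) :
  measurable_fun setT f -> measurable_fun setT g ->
  (forall x, 0 <= f x) -> (forall x, 0 <= g x) ->
  measurable_fun setT (ge0_potential f g).
Proof.
move=> mf mg f0 g0; apply: (measurable_fun_fubini_tonelli_F (m2 := lam)
  (fun p : T * T => (G p.2 * f (vsub p.1 p.2) * g (vadd p.1 p.2))%:E)).
- apply/measurable_EFinP; apply: measurable_bilinear_integrand => //.
  exact: measurable_bessel hG.
- by move=> p; rewrite lee_fin !mulr_ge0// (bessel_ge0 hG).
Qed.
(** Inequality in inhomogeneous form. The potential with kernel [G] is at most
    the series of the potentials with Gaussian kernels; the root of a series is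
    at most the series of the roots, and each term has the same bound
    [heat_bilinear_le], whatever the width. *)
Lemma ge0_potential_sum_le : exists C : R, 0 <= C /\ forall f g : T -> R,
  measurable_fun setT f -> measurable_fun setT g ->
  (forall x, 0 <= f x) -> (forall x, 0 <= g x) ->
  (\int[lam]_x (f x)%:E < +oo)%E -> (\int[lam]_x (g x)%:E < +oo)%E ->
  (\int[lam]_x ge0_potential f g x `^ 2^-1 <=
   C%:E * (\int[lam]_x (f x)%:E + \int[lam]_x (g x)%:E))%E.
Proof.
have [C [C0 HC]] := bessel_kernel_le s0 hG.
(* The roots of the coefficients of the series of Gaussians are again
   geometric, with ratio [q]. *)
pose q := expR (- s / 2).
have q01 : 0 <= q < 1.
  by rewrite expR_ge0/= expR_lt1 mulNr oppr_lt0 divr_gt0.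
have q2 j : expR (- s) ^+ j = (q ^+ j) ^+ 2.
  by rewrite -exprM mulnC exprM; congr (_ ^+ _); rewrite -expRM_natl; congr expR; field.
pose S := (\sum_(j <oo) (Num.sqrt C * q ^+ j)%:E)%E.
have S0 : (0 <= S)%E.
  by apply: nneseries_ge0 => j _ _; rewrite lee_fin mulr_ge0 ?sqrtr_ge0 ?exprn_ge0 ?expR_ge0.
have Sf : S \is a fin_num.
  by rewrite ge0_fin_numE//; apply: nneseries_geometric_lty => //; exact: sqrtr_ge0.
exists (fine S); split; first exact: fine_ge0.
move=> f g mf mg f0 g0 foo goo; rewrite fineK//.
pose P (w : R) (x : T) := (\int[lam]_y (heat w y * f (vsub x y) * g (vadd x y))%:E)%E.
have mint w : measurable_fun setT (fun p : T * T =>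
    (heat w p.2 * f (vsub p.1 p.2) * g (vadd p.1 p.2))%:E).
  apply/measurable_EFinP; apply: measurable_bilinear_integrand => //.
  exact: measurable_heat.
have int0 w x y : (0 <= (heat w y * f (vsub x y) * g (vadd x y))%:E)%E.
  by rewrite lee_fin !mulr_ge0 ?heat_ge0.
have mintx w x : measurable_fun setT (fun y : T =>
    (heat w y * f (vsub x y) * g (vadd x y))%:E).
  exact: (measurableT_comp (mint w) (pair1_measurable x)).
have mP w : measurable_fun setT (P w).
  by apply: (measurable_fun_fubini_tonelli_F _ (mint w)) => -[x y]; exact: int0.
have P0 w x : (0 <= P w x)%E by apply: integral_ge0 => y _; exact: int0.
have mGint : measurable_fun setT (fun p : T * T =>
    (G p.2 * f (vsub p.1 p.2) * g (vadd p.1 p.2))%:E).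
  apply/measurable_EFinP; apply: measurable_bilinear_integrand => //.
  exact: measurable_bessel hG.
have Gint0 x y : (0 <= (G y * f (vsub x y) * g (vadd x y))%:E)%E.
  by rewrite lee_fin !mulr_ge0// (bessel_ge0 hG).
have mF := measurable_ge0_potential mf mg f0 g0.
have F0 x := ge0_potential_ge0 x f0 g0.
pose a j : R := C * expR (- s) ^+ j.
have a0 j : 0 <= a j by rewrite mulr_ge0// exprn_ge0// expR_ge0.
pose w1 j : R := width j.+1%:R.
pose w2 j : R := width (- j%:R).
have key x : (ge0_potential f g x <= \sum_(j <oo) ((a j)%:E * (P (w1 j) x + P (w2 j) x)))%E.
  have aint0 j y : (0 <= (a j)%:E * ((heat (w1 j) y * f (vsub x y) * g (vadd x y))%:E +
     (heat (w2 j) y * f (vsub x y) * g (vadd x y))%:E))%E.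
    by rewrite mule_ge0// ?adde_ge0// lee_fin.
  have maint j : measurable_fun setT (fun y => (a j)%:E *
     ((heat (w1 j) y * f (vsub x y) * g (vadd x y))%:E +
     (heat (w2 j) y * f (vsub x y) * g (vadd x y))%:E))%E.
    by apply: measurable_funeM; apply: emeasurable_funD.
  apply: (@le_trans _ _ (\int[lam]_y \sum_(j <oo) ((a j)%:E *
    ((heat (w1 j) y * f (vsub x y) * g (vadd x y))%:E +
     (heat (w2 j) y * f (vsub x y) * g (vadd x y))%:E)))%E).
    apply: ae_ge0_le_integral => //.
    - exact: (measurableT_comp mGint (pair1_measurable x)).
    - by move=> y _; apply: nneseries_ge0.
    - apply: ge0_emeasurable_sum => //.
    - apply: filterS HC => y Gy _.
      rewrite -mulrA EFinM muleC.
      apply: (@le_trans _ _ ((f (vsub x y) * g (vadd x y))%:E * \sum_(j <oo) (C * expR (- s) ^+ j *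
         (heat (width j.+1%:R) y + heat (width (- j%:R)) y))%:E)%E).
        by rewrite lee_wpmul2l// lee_fin mulr_ge0.
      rewrite -nneseriesZl; last first.
        move=> j _; rewrite lee_fin; apply: mulr_ge0; first exact: a0.
        by rewrite addr_ge0 ?heat_ge0.
      rewrite le_eqVlt; apply/orP; left; apply/eqP; apply: eq_eseriesr => j _.
      rewrite -EFinD -!EFinM; congr (_%:E); rewrite /a /w1 /w2; ring.
  rewrite integral_nneseries//.
  rewrite le_eqVlt; apply/orP; left; apply/eqP; apply: eq_eseriesr => j _.
  rewrite ge0_integralZlT ?lee_fin//.
  - by rewrite ge0_integralD.
  - exact: emeasurable_funD.
  - by move=> y; exact: adde_ge0.
pose Q j x : \bar R := ((Num.sqrt C * q ^+ j)%:E *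
  (P (w1 j) x `^ 2^-1 + P (w2 j) x `^ 2^-1))%E.
have sq0 j : (0 <= (Num.sqrt C * q ^+ j)%:E)%E.
  by rewrite lee_fin mulr_ge0 ?sqrtr_ge0 ?exprn_ge0 ?expR_ge0.
have Q0 j x : (0 <= Q j x)%E by rewrite mule_ge0// adde_ge0// poweR_ge0.
have mQ j : measurable_fun setT (Q j).
  by apply: measurable_funeM; apply: emeasurable_funD; exact: measurable_poweR_half.
apply: (@le_trans _ _ (\int[lam]_x \sum_(j <oo) Q j x)%E).
  apply: ge0_le_integralT.
  - exact: measurable_poweR_half.
  - exact: ge0_emeasurable_sum.
  - by move=> x; exact: poweR_ge0.
  - move=> x; apply: (le_trans (le_poweR_half (F0 x) (key x))).
    apply: (le_trans (poweR_half_nneseries _)) => [j|].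
      by apply: mule_ge0; [rewrite lee_fin|exact: adde_ge0].
    apply: lee_nneseries => [j _ _|j _]; first exact: poweR_ge0.
    rewrite poweRM; [|by rewrite lee_fin|exact: adde_ge0].
    rewrite poweR_EFin powR12_sqrt//.
    rewrite /a q2 sqrtrM// sqrtr_sqr ger0_norm ?exprn_ge0 ?expR_ge0//.
    by rewrite lee_wpmul2l// poweR_half_add.
rewrite integral_nneseries//.
rewrite muleC; set AB := (_ + _)%E.
have AB0 : (0 <= AB)%E.
  by rewrite adde_ge0//; apply: integral_ge0 => x _; rewrite lee_fin.
have ABf : AB \is a fin_num by rewrite ge0_fin_numE// lte_add_pinfty.
apply: (@le_trans _ _ (\sum_(j <oo) ((Num.sqrt C * q ^+ j)%:E * AB))%E).
  apply: lee_nneseries => [j _ _|j _]; first by apply: integral_ge0.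
  rewrite ge0_integralZlT//; last 2 first.
  - by apply: emeasurable_funD; exact: measurable_poweR_half.
  - by move=> x; rewrite adde_ge0// poweR_ge0.
  rewrite lee_wpmul2l// ge0_integralD//; last 4 first.
  - by move=> x _; exact: poweR_ge0.
  - exact: measurable_poweR_half.
  - by move=> x _; exact: poweR_ge0.
  - exact: measurable_poweR_half.
  have h w : 0 < w -> (\int[lam]_x P w x `^ 2^-1 <= 2^-1%:E * AB)%E.
    by move=> w0; exact: heat_bilinear_le.
  apply: (le_trans (leeD (h _ (width_gt0 _)) (h _ (width_gt0 _)))).
  rewrite -ge0_muleDl ?lee_fin// -EFinD.
  by rewrite (_ : _ + _ = 1)%R ?mul1e//; field.
rewrite -[X in (_ <= X * _)%E](fineK ABf) -nneseriesZl//.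
under eq_eseriesr do rewrite muleC -[X in (X * _)%E](fineK ABf).
exact: lexx.
Qed.

(** Replacing [(f, g)] by [(l * f, l^-1 * g)] does not change the potential, so
    the inhomogeneous bound holds with all these weights. *)
Lemma ge0_potential_le : exists C : R, 0 <= C /\ forall f g : T -> R,
  measurable_fun setT f -> measurable_fun setT g ->
  (forall x, 0 <= f x) -> (forall x, 0 <= g x) ->
  (\int[lam]_x (f x)%:E < +oo)%E -> (\int[lam]_x (g x)%:E < +oo)%E ->
  let X := (\int[lam]_x ge0_potential f g x `^ 2^-1)%E in
  (X < +oo)%E /\
  (X * X <= C%:E * (\int[lam]_x (f x)%:E * \int[lam]_x (g x)%:E))%E.
Proof.
have [C [C0 HC]] := ge0_potential_sum_le.
exists (4 * C ^+ 2); split; first by rewrite mulr_ge0// sqr_ge0.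
move=> f g mf mg f0 g0 foo goo X.
have A0 : (0 <= \int[lam]_x (f x)%:E)%E by apply: integral_ge0 => x _; rewrite lee_fin.
have B0 : (0 <= \int[lam]_x (g x)%:E)%E by apply: integral_ge0 => x _; rewrite lee_fin.
have X0 : (0 <= X)%E by apply: integral_ge0 => x _; exact: poweR_ge0.
have Af : (\int[lam]_x (f x)%:E \is a fin_num)%E by rewrite ge0_fin_numE.
have Bf : (\int[lam]_x (g x)%:E \is a fin_num)%E by rewrite ge0_fin_numE.
have scaled (l : R) : 0 < l ->
    (X <= C%:E * (l%:E * \int[lam]_x (f x)%:E + l^-1%:E * \int[lam]_x (g x)%:E))%E.
  move=> l0; have li0 : 0 < l^-1 by rewrite invr_gt0.
  have If : (\int[lam]_x (l * f x)%:E = l%:E * \int[lam]_x (f x)%:E)%E.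
    under eq_integral do rewrite EFinM.
    by apply: ge0_integralZlT => //; [exact/measurable_EFinP|rewrite lee_fin ltW].
  have Ig : (\int[lam]_x (l^-1 * g x)%:E = l^-1%:E * \int[lam]_x (g x)%:E)%E.
    under eq_integral do rewrite EFinM.
    by apply: ge0_integralZlT => //; [exact/measurable_EFinP|rewrite lee_fin ltW].
  rewrite -If -Ig.
  have -> : X = (\int[lam]_x ge0_potential (fun x => l * f x)%R
      (fun x => l^-1 * g x)%R x `^ 2^-1)%E.
    apply: eq_integral => x _; congr (_ `^ _)%E; apply: eq_integral => y _.
    by congr (_%:E); field; rewrite gt_eqF.
  apply: HC.
  - exact: measurable_funM.
  - exact: measurable_funM.
  - by move=> x; rewrite mulr_ge0// ltW.
  - by move=> x; rewrite mulr_ge0// ltW.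
  - by rewrite If -(fineK Af) -EFinM ltry.
  - by rewrite Ig -(fineK Bf) -EFinM ltry.
have Xoo : (X < +oo)%E.
  apply: (le_lt_trans (scaled 1 ltr01)).
  by rewrite -(fineK Af) -(fineK Bf) -!EFinM ltry.
split => //.
have Xf : X \is a fin_num by rewrite ge0_fin_numE.
move: scaled; rewrite -(fineK Xf) -(fineK Af) -(fineK Bf) => scaled.
rewrite -!EFinM lee_fin -expr2; apply: sqr_le_of_scaling => //; exact: fine_ge0.
Qed.

End bilinear_bound.

Theorem lemma4p3 (R : realType) (n : nat) (hn : (1 <= n)%N)
    (s : R) (hs0 : 0 < s) (hsn : s < n%:R)
    (G : n.-tuple R -> R) (hG : is_bessel_kernel s G) :
  bilinear_potential_bounded G 1%E 1%E (2^-1)%:E.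
Proof.
(* The factor 2 is that of [normc_cintegral_le]: its root appears under the
   integral, and the L^(1/2) norm squares it again. *)
have [C [C0 HC]] := ge0_potential_le hs0 hG.
pose nrm := @ComplexField.Normc.normc R.
exists (2 * C) => f g [cf foo] [cg goo].
pose nf x := nrm (f x); pose ng x := nrm (g x).
have nf0 x : 0 <= nf x by exact: normc_ge0.
have ng0 x : 0 <= ng x by exact: normc_ge0.
have mnf : measurable_fun setT nf by exact: measurable_normc.
have mng : measurable_fun setT ng by exact: measurable_normc.
have N1 (h : n.-tuple R -> R[i]) : cLnorm (lebesgueT R n) 1 h =
    (\int[lebesgueT R n]_x (nrm (h x))%:E)%E.
  rewrite /cLnorm Lnorm1; apply: eq_integral => x _.
  by rewrite /= ger0_norm// normc_ge0.
rewrite N1 -/nf in foo; rewrite N1 -/ng in goo.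
have [Xoo HX] := HC nf ng mnf mng nf0 ng0 foo goo.
set X := (\int[lebesgueT R n]_x _)%E in Xoo HX.
have mF := measurable_ge0_potential hG mnf mng nf0 ng0.
have F0 x := ge0_potential_ge0 hG x nf0 ng0.
have cI : cmeasurable (fun p : n.-tuple R * n.-tuple R =>
    potential_integrand G f g p.1 p.2).
  have [_ [cG _] _] := hG.
  apply: cmeasurableM; first apply: cmeasurableM.
  - exact: (cmeasurable_comp (phi := snd) _ cG).
  - apply: (cmeasurable_comp (phi := fun p => vsub p.1 p.2) _ cf).
    exact: measurable_vsub.
  - apply: (cmeasurable_comp (phi := fun p => vadd p.1 p.2) _ cg).
    exact: measurable_vadd.
have cIx x : cmeasurable (potential_integrand G f g x).
  exact: (cmeasurable_comp (pair1_measurable x) cI).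
have nI x : (\int[lebesgueT R n]_y (nrm (potential_integrand G f g x y))%:E =
    ge0_potential G nf ng x)%E.
  apply: eq_integral => y _; congr (_%:E).
  rewrite /potential_integrand /nrm !ComplexField.Normc.normcM normc_real.
  by rewrite ger0_norm// (bessel_ge0 hG).
have cB : cmeasurable (bilinear_potential G f g).
  have [rI iI] := cI.
  by split; [exact: (measurable_Rintegral (lebesgueT R n) rI)
            |exact: (measurable_Rintegral (lebesgueT R n) iI)].
have bound : (cLnorm (lebesgueT R n) (2^-1)%:E (bilinear_potential G f g) <=
    (2 * C)%:E * cLnorm (lebesgueT R n) 1 f * cLnorm (lebesgueT R n) 1 g)%E.
  rewrite !N1 -/nf -/ng /cLnorm unlock invrK.
  have k0 : (0 <= 2%:E `^ 2^-1 :> \bar R)%E by exact: poweR_ge0.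
  have Y0 : (0 <= \int[lebesgueT R n]_x (`|(EFin \o (nrm \o bilinear_potential G f g)) x|
      `^ 2^-1))%E by apply: integral_ge0 => x _; exact: poweR_ge0.
  have X0 : (0 <= X)%E by apply: integral_ge0 => x _; exact: poweR_ge0.
  have YX : (\int[lebesgueT R n]_x (`|(EFin \o (nrm \o bilinear_potential G f g)) x|
      `^ 2^-1) <= 2%:E `^ 2^-1 * X)%E.
    rewrite -ge0_integralZlT//; last 2 first.
    - exact: measurable_poweR_half.
    - by move=> x; exact: poweR_ge0.
    apply: ge0_le_integralT.
    - apply: measurable_poweR_half; apply: measurableT_comp => //.
      by apply/measurable_EFinP; exact: measurable_normc.
    - by apply: measurable_funeM; exact: measurable_poweR_half.
    - by move=> x; exact: poweR_ge0.
    - move=> x; rewrite -poweRM//; apply: le_poweR_half; first exact: abse_ge0.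
      rewrite gee0_abs ?lee_fin ?normc_ge0// -nI.
      exact: normc_cintegral_le.
  rewrite poweR2//; apply: (le_trans (lee_pmul Y0 Y0 YX YX)).
  rewrite muleACA poweR_half_sq// EFinM -!muleA.
  by rewrite lee_wpmul2l// lee_fin.
have Ff : {ae lebesgueT R n, forall x, (ge0_potential G nf ng x < +oo)%E}.
  have iX : (lebesgueT R n).-integrable setT
      (fun x => ge0_potential G nf ng x `^ 2^-1)%E.
    apply/integrableP; split; first exact: measurable_poweR_half.
    by under eq_integral do rewrite gee0_abs ?poweR_ge0//.
  apply: filterS (integrable_ae measurableT iX) => x /(_ I).
  rewrite fin_num_abs => h; apply: (@lty_poweRy _ _ 2^-1); first by rewrite invr_eq0.
  by move: h; rewrite gee0_abs ?poweR_ge0.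
split => //.
- by apply: filterS Ff => x Fx; split => //; rewrite N1 nI.
- split => //; apply: (le_lt_trans bound); rewrite !N1 -/nf -/ng.
  have Af : (\int[lebesgueT R n]_x (nf x)%:E \is a fin_num)%E.
    by rewrite ge0_fin_numE//; apply: integral_ge0 => x _; rewrite lee_fin.
  have Bf : (\int[lebesgueT R n]_x (ng x)%:E \is a fin_num)%E.
    by rewrite ge0_fin_numE//; apply: integral_ge0 => x _; rewrite lee_fin.
  by rewrite -(fineK Af) -(fineK Bf) -!EFinM ltry.
Qed.
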